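(* Suppose that $\varphi_z\in L^2(\mathbb R_+)$ and $\theta_z\in L^2(\mathbb R_+)$ for all $z\in\mathbb C$. For $t\in\mathbb R\cup\{\infty\}$ let $A_t$ be the restriction of $A_{\max}$ to the domain $$\mathcal D(A_t)=\mathcal D(A_{\min})\dotplus\{t\varphi_0+\tilde\theta_0\}\ \ (t\in\mathbb R),\qquad \mathcal D(A_\infty)=\mathcal D(A_{\min})\dotplus\{\varphi_0\},$$ where $\{h\}$ denotes the one-dimensional subspace spanned by $h$ and $\dotplus$ the direct sum of subspaces. Then all operators $A_t$, $t\in\mathbb R\cup\{\infty\}$, are self-adjoint. Conversely, every operator $A$ in $L^2(\mathbb R_+)$ satisfying $$A_{\min}\subset A=A^*\subset A_{\max}$$ coincides with one of the operators $A_t$ for some $t\in\mathbb R\cup\{\infty\}$.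
   Context: $\mathbb R_+=(0,\infty)$; $\langle\cdot,\cdot\rangle$ is the scalar product of the complex space $L^2(\mathbb R_+)$, linear in the first argument. Let $p\in C^1(\mathbb R_+)$, $q\in C(\mathbb R_+)$ be real functions having finite limits as $x\to0$, with $p(x)>0$ for all $x\ge0$ (including the limit $p(0)>0$). Put $(\mathcal A u)(x)=-(p(x)u'(x))'+q(x)u(x)$. Fix $\alpha\in\mathbb R\cup\{\infty\}$ and consider the boundary condition (BC): $u'(0)=\alpha u(0)$ (for $\alpha=\infty$ this means $u(0)=0$), where $u(0)=u(+0)$, $u'(0)=u'(+0)$. Solutions: for $z\in\mathbb C$, $\varphi_z$ and $\theta_z$ are the solutions of $-(pu')'+qu=zu$ on $\mathbb R_+$ with $\varphi_z(0)=1$, $\varphi_z'(0)=\alpha$, $\theta_z(0)=0$, $\theta_z'(0)=-p(0)^{-1}$ if $\alpha\in\mathbb R$, and $\varphi_z(0)=0$, $\varphi_z'(0)=1$, $\theta_z(0)=p(0)^{-1}$, $\theta_z'(0)=0$ if $\alpha=\infty$. Fix a cut-off function $\omega\in C^\infty(\mathbb R_+)$ with $\omega(x)=0$ for small $x$ and $\omega(x)=1$ for large $x$, and put $\tilde\theta_z(x)=\omega(x)\theta_z(x)$. Operators: $A_{00}u=\mathcal Au$ with domain $\mathcal D(A_{00})$ consisting of $u\in C^2(\mathbb R_+)$ such that $u(x)=0$ for sufficiently large $x$, the limits $u(+0),u'(+0)$ exist, (BC) holds, and $\mathcal Au\in L^2(\mathbb R_+)$. $A_{\min}$ is the closure of $A_{00}$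 in $L^2(\mathbb R_+)$. $A_{\max}=A_{\min}^*$; it acts by $A_{\max}u=\mathcal Au$ on the set $\mathcal D(A_{\max})$ of $u$ belonging locally (on $(0,\infty)$) to the Sobolev space $\mathsf H^2$, satisfying (BC), and such that $u\in L^2(\mathbb R_+)$, $\mathcal Au\in L^2(\mathbb R_+)$. *)

(* Defs.v *)
(* Functions on the half-line are total functions R -> R[i]; only their
   values on `]0, +oo[ are relevant. Limits, derivatives, measurability
   and integrals of complex-valued functions are taken componentwise. *)
From mathcomp Require Import all_boot all_order all_algebra.
From mathcomp Require Import all_classical all_reals all_analysis.
From mathcomp Require Import complex.

Set Implicit Arguments.
Unset Strict Implicit.
Unset Printing Implicit Defensive.

Import Order.TTheory GRing.Theory Num.Theory.
Import numFieldNormedType.Exports.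

Local Open Scope classical_set_scope.
Local Open Scope ring_scope.
Local Open Scope complex_scope.

Section L2.
Context {R : realType}.
Implicit Types u v f g : R -> R[i].

Definition halfline : set R := [set x | 0 < x].

Definition cintegral f : R[i] :=
  (\int[lebesgue_measure]_(x in halfline) complex.Re (f x))
  +i* (\int[lebesgue_measure]_(x in halfline) complex.Im (f x)).

Definition sqnorm (z : R[i]) : R := complex.Re z ^+ 2 + complex.Im z ^+ 2.

Definition in_L2 u : Prop :=
  [/\ measurable_fun halfline (fun x => complex.Re (u x)),
      measurable_fun halfline (fun x => complex.Im (u x)) &
      (\int[lebesgue_measure]_(x in halfline) (sqnorm (u x))%:E < +oo)%E].

(* Equality in L^2(R_+): elements of L^2 are represented by functions up to
   this relation. *)
Definition L2eq u v : Prop := ae_eq lebesgue_measure halfline u v.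

Definition L2dot u v : R[i] := cintegral (fun x => u x * (v x)^*).

Definition L2dist u v : R :=
  Num.sqrt (\int[lebesgue_measure]_(x in halfline) sqnorm (u x - v x)).

End L2.

(* Operators in L^2(R_+), represented by their graphs. *)
Definition graph (R : realType) := set ((R -> R[i]) * (R -> R[i])).

Section Operators.
Context {R : realType}.
Implicit Types (u v f g : R -> R[i]) (S : set (R -> R[i])).

Implicit Types T : graph R.

(* A linear operator in L^2(R_+): the graph is a linear, single-valued set of
   pairs of L^2 functions, invariant under a.e. modification. *)
Definition is_operator T : Prop :=
  [/\ (forall u f, T (u, f) -> in_L2 u /\ in_L2 f),
      (forall u f v g, T (u, f) -> in_L2 v -> in_L2 g ->
         L2eq u v -> L2eq f g -> T (v, g)),
      T (fun=> 0, fun=> 0),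
      (forall (c : R[i]) u f v g, T (u, f) -> T (v, g) ->
         T (fun x => c * u x + v x, fun x => c * f x + g x)) &
      (forall u f g, T (u, f) -> T (u, g) -> L2eq f g)].

Definition domain T : set (R -> R[i]) := [set u | exists f, T (u, f)].

Definition op_closure T : graph R :=
  [set uf | [/\ in_L2 uf.1, in_L2 uf.2 &
     forall e : R, 0 < e -> exists v g,
       [/\ T (v, g), L2dist uf.1 v < e & L2dist uf.2 g < e]]].

Definition adjoint T : graph R :=
  [set vg | [/\ in_L2 vg.1, in_L2 vg.2 &
     forall u f, T (u, f) -> L2dot f vg.1 = L2dot u vg.2]].

Definition densely_defined T : Prop :=
  forall u, in_L2 u -> forall e : R, 0 < e ->
    exists2 v, domain T v & L2dist u v < e.

Definition self_adjoint T : Prop :=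
  [/\ is_operator T, densely_defined T & T = adjoint T].

Definition op_restrict T S : graph R := [set uf | T uf /\ S uf.1].

(* Pointwise equality loses nothing: domains of operators are invariant under
   a.e. modification within L^2, and h will be in L^2. *)
Definition add_line S (h : R -> R[i]) : set (R -> R[i]) :=
  [set u | exists v (c : R[i]), S v /\ u = (fun x => v x + c * h x)].

(* h is nonzero and S intersects the line spanned by h trivially. *)
Definition direct_line S (h : R -> R[i]) : Prop :=
  forall c : R[i], S (fun x => c * h x) -> c = 0.

End Operators.

Section SturmLiouville.
Context {R : realType}.
Implicit Types u v f g : R -> R[i].

(* The class C^k(R_+) of real functions: no condition at 0. *)
Definition Ck (k : nat) (f : R -> R) : Prop :=
  (forall j x, (j < k)%N -> 0 < x -> derivable (derive1n j f) x 1) /\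
  (forall x, 0 < x -> {for x, continuous (derive1n k f)}).

Definition Csmooth (f : R -> R) : Prop := forall k, Ck k f.

Definition cCk (k : nat) u : Prop :=
  Ck k (fun x => complex.Re (u x)) /\ Ck k (fun x => complex.Im (u x)).

Definition cderivable u (x : R) : Prop :=
  derivable (fun y => complex.Re (u y)) x 1 /\ derivable (fun y => complex.Im (u y)) x 1.

Definition cderiv u : R -> R[i] := fun x =>
  derive1 (fun y => complex.Re (u y)) x +i* derive1 (fun y => complex.Im (u y)) x.

(* u(+0) exists and equals a. *)
Definition limit0 u (a : R[i]) : Prop :=
  (complex.Re (u x) @[x --> 0^'+] --> complex.Re a) /\ (complex.Im (u x) @[x --> 0^'+] --> complex.Im a).

Definition initial_data u (a b : R[i]) : Prop :=
  limit0 u a /\ limit0 (cderiv u) b.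

(* A parameter in R \cup {oo} is an option R, with None standing for oo. *)
Definition boundary_condition (alpha : option R) u : Prop :=
  exists a b, initial_data u a b /\
    (if alpha is Some al then b = al%:C * a else a = 0).

Definition SLexpr (p q : R -> R) u : R -> R[i] := fun x =>
  - cderiv (fun y => (p y)%:C * cderiv u y) x + (q x)%:C * u x.

Definition SLsolution (p q : R -> R) (z : R[i]) u : Prop :=
  forall x : R, 0 < x ->
    [/\ cderivable u x, cderivable (fun y => (p y)%:C * cderiv u y) x &
        SLexpr p q u x = z * u x].

Definition phi_data (alpha : option R) u : Prop :=
  if alpha is Some al then initial_data u 1 al%:C else initial_data u 0 1.

(* p0 is the limit p(0). *)
Definition theta_data (p0 : R) (alpha : option R) u : Prop :=
  if alpha is Some _ then initial_data u 0 (- (p0^-1)%:C)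
  else initial_data u (p0^-1)%:C 0.

Definition domA00 (p q : R -> R) (alpha : option R) : set (R -> R[i]) :=
  [set u | [/\ cCk 2 u, (\forall x \near +oo, u x = 0),
               boundary_condition alpha u & in_L2 (SLexpr p q u)]].

Definition A00 (p q : R -> R) (alpha : option R) : graph R :=
  [set vg | [/\ in_L2 vg.1, in_L2 vg.2 &
     exists2 u, domA00 p q alpha u &
       L2eq vg.1 u /\ L2eq vg.2 (SLexpr p q u)]].

Definition Amin (p q : R -> R) (alpha : option R) : graph R :=
  op_closure (A00 p q alpha).

Definition Amax (p q : R -> R) (alpha : option R) : graph R :=
  adjoint (Amin p q alpha).

Definition cutoff (omega : R -> R) : Prop :=
  [/\ Csmooth omega, (\forall x \near 0^'+, omega x = 0) &
      (\forall x \near +oo, omega x = 1)].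

(* The vector added to D(A_min) in the definition of D(A_t); here phi0, theta0
   are the solutions for z = 0. *)
Definition ext_vector (omega : R -> R) (phi0 theta0 : R -> R[i])
    (t : option R) : R -> R[i] :=
  if t is Some t' then fun x => t'%:C * phi0 x + (omega x)%:C * theta0 x
  else phi0.

Definition At (p q : R -> R) (alpha : option R) (omega : R -> R)
    (phi0 theta0 : R -> R[i]) (t : option R) : graph R :=
  op_restrict (Amax p q alpha)
    (add_line (domain (Amin p q alpha)) (ext_vector omega phi0 theta0 t)).

End SturmLiouville.

(* Main.v *)
(* At z = 0 the solutions phi and theta are real, with Wronskian
   p (phi' theta - phi theta') = 1. As both lie in L^2, the Green operator
     (G f)(x) = theta(x) \int_0^x phi f + phi(x) \int_x^oo theta f
   is everywhere defined, bounded and symmetric on L^2. Green's formula and the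
   density of compactly supported functions identify the graph of A_min with
   {(G f, f) : <f, phi> = 0}, whence by duality the graph of A_max is
   {(G f + c phi, f) : c complex}. With f0 = A(omega theta) one has
   omega theta = G f0 and <f0, phi> = 1, so the graph of A_t is
   {(G f + t <f, phi> phi, f)} for real t and
   {(G f + c phi, f) : <f, phi> = 0} for t = oo. Thus A_t is the inverse of the
   bounded symmetric operator G + t <., phi> phi, hence self-adjoint. Conversely,
   if a self-adjoint A between A_min and A_max contains some (G f + tau phi, f)
   with <f, phi> = 1, symmetry forces tau to be real and A contains A_tau;
   otherwise A is contained in A_oo. In either case A equals that extension,
   both being self-adjoint. *)
Require Import Defs.
From mathcomp Require Import all_boot all_order all_algebra.
From mathcomp Require Import all_classical all_reals all_analysis.
From mathcomp Require Import measurable_realfun complex ring lra.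

Set Implicit Arguments.
Unset Strict Implicit.
Unset Printing Implicit Defensive.

Import Order.TTheory GRing.Theory Num.Theory.
Import numFieldNormedType.Exports.

Local Open Scope classical_set_scope.
Local Open Scope ring_scope.
Local Open Scope complex_scope.

(** * Real square-integrable functions on the half-line *)

(** The condition <f, phi> = 0 comes from infinity: beyond the support of f one has G f = <f, phi>
    theta, while functions in the domain of A_00 vanish for large x. Below the support of f, G f is
    a multiple of phi and so inherits the boundary condition. Questions about domains thus become
    linear conditions on the right-hand side f, and A_max, being an adjoint, is computed inside L^2
    from the symmetry of G. The obstacle is to reach every (G f, f) with <f, phi> = 0 from A_00: the
    approximants of f must be exactly orthogonal to phi, since otherwise G leaves a nonzero multiple
    of theta at infinity. The function f0 = A(omega theta) supplies the correction and later
    represents the one missing direction of right-hand sides. The value <f0, phi> = 1 is the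
    increase of the Wronskian of phi and omega theta, from 0 near 0 to 1 far out. Since phi and
    theta are real, G preserves real functions, so the analysis is done for real functions and
    complexified afterwards. Reality itself follows from the real initial data by Wronskians. *)

Section RealL2.
Context {R : realType}.
Implicit Types f g h : R -> R.
Notation mu := (@lebesgue_measure R).
Notation D := (@halfline R).

Lemma halflineE : D = `]0, +oo[%classic.
Proof. by apply/seteqP; split => x /=; rewrite in_itv/= andbT. Qed.

Lemma measurable_halfline : measurable D.
Proof. by rewrite halflineE; exact: measurable_itv. Qed.
Hint Resolve measurable_halfline : core.

(** Measurability of [f] is a separate clause because integrability of the square does not imply
    it. *)
Definition real_L2 f : Prop :=
  measurable_fun D f /\ mu.-integrable D (EFin \o (fun x => f x ^+ 2)).

Definition rdot f g : R := \int[mu]_(x in D) (f x * g x).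

(** The product is dominated by $f^2+g^2$, as $(f\pm g)^2\ge 0$. *)
Lemma real_L2M f g : real_L2 f -> real_L2 g ->
  mu.-integrable D (EFin \o (fun x => f x * g x)).
Proof.
move=> [mf if2] [mg ig2]; apply: (le_integrable _ _ _ (integrableD _ if2 ig2)) => //.
  by apply/measurable_EFinP; exact: measurable_funM.
move=> x _ /=; rewrite lee_fin [leRHS]ger0_norm ?addr_ge0 ?sqr_ge0//.
have := sqr_ge0 (f x - g x); have := sqr_ge0 (f x + g x).
by rewrite ler_norml => ? ?; apply/andP; split; nra.
Qed.

Lemma real_L2_lin (c : R) f g : real_L2 f -> real_L2 g ->
  real_L2 (fun x => c * f x + g x).
Proof.
move=> Lf Lg; split.
  apply: measurable_funD; last exact: Lg.1.
  by apply: measurable_funM => //; exact: Lf.1.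
have -> : EFin \o (fun x => (c * f x + g x) ^+ 2) =
    ((fun x => (c ^+ 2)%:E * (EFin \o (fun x => f x ^+ 2)%R) x) \+
    ((fun x => (2 * c)%:E * (EFin \o (fun x => f x * g x)%R) x) \+
    (EFin \o (fun x => g x ^+ 2)%R)))%E.
  by apply/funext => x /=; congr EFin; ring.
apply: integrableD => //; last apply: integrableD => //; last exact: Lg.2.
  by apply: integrableZl => //; exact: Lf.2.
by apply: integrableZl => //; exact: real_L2M.
Qed.

Lemma real_L2_0 : real_L2 (fun=> 0).
Proof.
split; first exact: measurable_cst.
apply: eq_integrable (integrable0 mu D) => // x _ /=.
by rewrite expr0n.
Qed.

Lemma real_L2Z (c : R) f : real_L2 f -> real_L2 (fun x => c * f x).
Proof.
move=> Lf; have := real_L2_lin c Lf real_L2_0.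
by under eq_fun do rewrite addr0.
Qed.

Lemma real_L2D f g : real_L2 f -> real_L2 g -> real_L2 (fun x => f x + g x).
Proof.
move=> Lf Lg; have := real_L2_lin 1 Lf Lg.
by under eq_fun do rewrite mul1r.
Qed.

Lemma real_L2B f g : real_L2 f -> real_L2 g -> real_L2 (fun x => f x - g x).
Proof.
move=> Lf Lg; have := real_L2_lin (-1) Lg Lf.
by under eq_fun do rewrite mulN1r addrC.
Qed.

Lemma real_L2_le f g : measurable_fun D f -> real_L2 g ->
  (forall x, 0 < x -> `|f x| <= `|g x|) -> real_L2 f.
Proof.
move=> mf [mg ig2] fg; split => //; apply: le_integrable ig2 => //.
  by apply/measurable_EFinP; exact: measurable_funX.
move=> x Dx /=; rewrite lee_fin !normrX.
by rewrite lerXn2r// ?nnegrE//; exact: fg.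
Qed.

Lemma real_L2_ae f g : real_L2 f -> measurable_fun D g -> ae_eq mu D f g ->
  real_L2 g.
Proof.
move=> [mf /integrableP[_ if2]] mg fg; split => //; apply/integrableP; split.
  by apply/measurable_EFinP; exact: measurable_funX.
apply: le_lt_trans if2; rewrite le_eqVlt; apply/orP; left; apply/eqP.
apply: ae_eq_integral => //.
- by apply: measurableT_comp => //; apply/measurable_EFinP; exact: measurable_funX.
- by apply: measurableT_comp => //; apply/measurable_EFinP; exact: measurable_funX.
- apply: ae_eq_sym.
  exact: (@ae_eq_comp _ _ _ mu D _ _ (fun y : R => `|(y ^+ 2)%:E|%E)).
Qed.

Lemma rdotC f g : rdot f g = rdot g f.
Proof. by rewrite /rdot; under eq_Rintegral do rewrite mulrC. Qed.

Lemma rdot_linl (c : R) f g h : real_L2 f -> real_L2 g -> real_L2 h ->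
  rdot (fun x => c * f x + g x) h = c * rdot f h + rdot g h.
Proof.
move=> Lf Lg Lh; rewrite /rdot -RintegralZl//; last exact: real_L2M.
rewrite -RintegralD//; last exact: real_L2M.
  by apply: eq_Rintegral => x _; ring.
by rewrite (_ : _ \o _ = (fun x => c%:E * (EFin \o (fun x => f x * h x)%R) x)%E)//;
   apply: integrableZl => //; exact: real_L2M.
Qed.

Lemma rdot0l f : rdot (fun=> 0) f = 0.
Proof.
rewrite /rdot; under eq_Rintegral do rewrite mul0r.
by rewrite /Rintegral integral0.
Qed.

Lemma rdotZl (c : R) f g : real_L2 f -> real_L2 g ->
  rdot (fun x => c * f x) g = c * rdot f g.
Proof.
move=> Lf Lg; have := rdot_linl c Lf real_L2_0 Lg.
by under eq_fun do rewrite addr0; rewrite rdot0l addr0.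
Qed.

Lemma rdotDl f g h : real_L2 f -> real_L2 g -> real_L2 h ->
  rdot (fun x => f x + g x) h = rdot f h + rdot g h.
Proof.
move=> Lf Lg Lh; have := rdot_linl 1 Lf Lg Lh.
by under eq_fun do rewrite mul1r; rewrite mul1r.
Qed.

Lemma rdotBl f g h : real_L2 f -> real_L2 g -> real_L2 h ->
  rdot (fun x => f x - g x) h = rdot f h - rdot g h.
Proof.
move=> Lf Lg Lh; have := rdot_linl (-1) Lg Lf Lh.
by under eq_fun do rewrite mulN1r addrC; rewrite mulN1r addrC.
Qed.

Lemma rdot_ge0 f : 0 <= rdot f f.
Proof. by apply: Rintegral_ge0 => x _; rewrite -expr2 sqr_ge0. Qed.

Lemma rdot_ae f f' g g' : real_L2 f -> real_L2 g ->
  measurable_fun D f' -> measurable_fun D g' ->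
  ae_eq mu D f f' -> ae_eq mu D g g' -> rdot f g = rdot f' g'.
Proof.
move=> Lf Lg mf' mg' ff' gg'; rewrite /rdot /Rintegral; congr fine.
have Lf' := real_L2_ae Lf mf' ff'; have Lg' := real_L2_ae Lg mg' gg'.
apply: ae_eq_integral => //.
- by apply: measurable_int; exact: real_L2M.
- by apply: measurable_int; exact: real_L2M.
- apply: filterS2 ff' gg' => x ffx ggx Dx.
  by rewrite ffx// ggx.
Qed.

Lemma rdot_eq0 f : real_L2 f -> rdot f f = 0 -> ae_eq mu D f (fun=> 0).
Proof.
move=> Lf f0; have if2 := real_L2M Lf Lf.
have : (\int[mu]_(x in D) `|(f x * f x)%:E| = 0)%E.
  rewrite -[RHS]/(0%:E) -f0 /rdot /Rintegral fineK ?integrable_fin_num//.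
  by apply: eq_integral => x _; rewrite gee0_abs// lee_fin -expr2 sqr_ge0.
move/(ae_eq_integral_abs mu measurable_halfline (measurable_int _ if2)).
apply: filterS => x + Dx => /(_ Dx) [] /eqP.
by rewrite mulf_eq0 orbb => /eqP.
Qed.

Lemma rdot_CS f g : real_L2 f -> real_L2 g ->
  rdot f g ^+ 2 <= rdot f f * rdot g g.
Proof.
move=> Lf Lg.
have quad (c : R) : 0 <= c ^+ 2 * rdot f f + 2 * c * rdot f g + rdot g g.
  have := rdot_ge0 (fun x => c * f x + g x).
  rewrite rdot_linl//; last exact: real_L2_lin.
  rewrite rdotC (rdotC g) !rdot_linl// (rdotC g f).
  by move=> h; apply: le_trans h _; rewrite le_eqVlt; apply/orP; left; apply/eqP; ring.
have := rdot_ge0 f; rewrite le_eqVlt => /predU1P[ff0|ff0]; last first.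
  (* The minimiser of the quadratic polynomial [quad]. *)
  have := quad (- rdot f g / rdot f f).
  set a := rdot f f in ff0 *; set b := rdot f g; set c := rdot g g.
  have -> : (- b / a) ^+ 2 * a + 2 * (- b / a) * b + c = (a * c - b ^+ 2) / a.
    by field; rewrite gt_eqF.
  by rewrite pmulr_lge0 ?invr_gt0// subr_ge0.
rewrite -ff0 mul0r; have [->|b0] := eqVneq (rdot f g) 0; first by rewrite expr0n.
(* In the degenerate case the polynomial is affine with nonzero slope; at this point it would take
   the value -1. *)
have := quad (- (rdot g g + 1) / (2 * rdot f g)); rewrite -ff0.
have -> : (- (rdot g g + 1) / (2 * rdot f g)) ^+ 2 * 0 +
   2 * (- (rdot g g + 1) / (2 * rdot f g)) * rdot f g + rdot g g = -1.
  by field.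
by rewrite lerNr oppr0 ler10.
Qed.

Definition rnorm f : R := Num.sqrt (rdot f f).

Lemma rnorm_ge0 f : 0 <= rnorm f. Proof. exact: sqrtr_ge0. Qed.

Lemma rnorm2 f : rnorm f ^+ 2 = rdot f f.
Proof. by rewrite sqr_sqrtr// rdot_ge0. Qed.

Lemma rdot_norm f g : real_L2 f -> real_L2 g -> `|rdot f g| <= rnorm f * rnorm g.
Proof.
move=> Lf Lg; rewrite -(@ler_sqr _ `|_|) ?nnegrE ?mulr_ge0 ?rnorm_ge0//.
by rewrite real_normK ?num_real// exprMn !rnorm2 rdot_CS.
Qed.

Lemma rnorm_triangle f g : real_L2 f -> real_L2 g ->
  rnorm (fun x => f x + g x) <= rnorm f + rnorm g.
Proof.
move=> Lf Lg; rewrite -ler_sqr ?nnegrE ?addr_ge0 ?rnorm_ge0//.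
rewrite rnorm2 rdotDl//; last exact: real_L2D.
rewrite rdotC (rdotC g) !rdotDl// -!rnorm2 (rdotC g f).
have := rdot_norm Lf Lg; rewrite ler_norml => /andP[_].
by move: (rnorm2 f) (rnorm2 g) => _ _ h; rewrite sqrrD; lra.
Qed.

Lemma rnormZ (c : R) f : real_L2 f -> rnorm (fun x => c * f x) = `|c| * rnorm f.
Proof.
move=> Lf; rewrite /rnorm rdotZl//; last exact: real_L2Z.
by rewrite rdotC rdotZl// mulrA -expr2 sqrtrM ?sqr_ge0// sqrtr_sqr.
Qed.

End RealL2.

(** * Primitives of integrable functions *)

Section Primitive.
Context {R : realType}.
Implicit Types f g h a b F : R -> R.
Notation mu := (@lebesgue_measure R).
Notation D := (@halfline R).
Let mD : measurable D := measurable_halfline.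
Hint Resolve mD : core.

Definition int_below f (x : R) : R := \int[mu]_(t in `]0, x]) f t.
Definition int_above f (x : R) : R := \int[mu]_(t in `]x, +oo[) f t.

Lemma halfline_setU (x : R) : 0 < x -> D = `]0, x] `|` `]x, +oo[.
Proof.
move=> x0; apply/seteqP; split => y /=; rewrite !in_itv/= ?andbT.
  by move=> ->/=; have [|] := leP y x; [left|right].
by move=> [/andP[]//|/(lt_trans x0)].
Qed.

Lemma subset_itv0_halfline (b : itv_bound R) :
  [set` Interval (BRight 0) b] `<=` D.
Proof. by move=> y /=; rewrite in_itv/= => /andP[]. Qed.

Lemma integrable_itv0 f (b : itv_bound R) : mu.-integrable D (EFin \o f) ->
  mu.-integrable [set` Interval (BRight 0) b] (EFin \o f).
Proof.
by apply: integrableS => //; exact: subset_itv0_halfline.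
Qed.

Lemma int_belowDabove f (x : R) : mu.-integrable D (EFin \o f) -> 0 < x ->
  int_below f x + int_above f x = \int[mu]_(t in D) f t.
Proof.
move=> intf x0; rewrite (halfline_setU x0) Rintegral_setU//.
  by rewrite -halfline_setU.
apply/disj_set2P; rewrite -subset0 => z/=; rewrite !in_itv/= => -[/andP[_]].
by rewrite leNgt => /negbTE ->.
Qed.

(** Extending [f] by zero to the line turns [int_below] into an integral with variable endpoint,
    whose continuity, also at 0, can be invoked. *)
Lemma int_belowE f (x : R) : mu.-integrable D (EFin \o f) ->
  int_below f x = parameterized_integral mu 0 x (f \_ D).
Proof.
move=> intf; rewrite /parameterized_integral -Rintegral_itv_obnd_cbnd.
  apply: eq_Rintegral => t; rewrite inE/= in_itv/= => /andP[t0 _].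
  by rewrite patchE mem_set.
apply: (@integrableS _ _ _ mu setT) => //.
by rewrite -restrict_EFin -integrable_mkcond.
Qed.

Lemma int_below_cvg0 f : mu.-integrable D (EFin \o f) ->
  int_below f x @[x --> 0^'+] --> 0.
Proof.
move=> intf; under eq_cvg do rewrite int_belowE//.
apply: cvg_at_right_filter.
apply: (@parameterized_integral_cvg_left _ _ 1) => //.
apply: (@integrableS _ _ _ mu setT) => //.
by rewrite -restrict_EFin -integrable_mkcond.
Qed.

Lemma continuous_int_below f (x : R) : mu.-integrable D (EFin \o f) -> 0 < x ->
  {for x, continuous (int_below f)}.
Proof.
move=> intf x0.
have -> : int_below f = fun x => parameterized_integral mu 0 x (f \_ D).
  by apply/funext => y; rewrite int_belowE.
have x1 : (0 : R) < x + 1 by rewrite addr_gt0.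
have : {within `[0, x + 1], continuous (fun x => parameterized_integral mu 0 x (f \_ D))}.
  apply: parameterized_integral_continuous; first exact: ltW.
  apply: (@integrableS _ _ _ mu setT) => //.
  by rewrite -restrict_EFin -integrable_mkcond.
move=> /(continuous_within_itvP _ x1)[+ _ _]; apply.
by rewrite in_itv/= x0 ltrDl ltr01.
Qed.

Lemma open_halfline : open D.
Proof. by rewrite halflineE; exact: interval_open. Qed.

Lemma measurable_continuous_halfline f :
  (forall x : R, 0 < x -> {for x, continuous f}) -> measurable_fun D f.
Proof.
move=> cf; apply: open_continuous_measurable_fun; first exact: open_halfline.
by move=> x; rewrite inE/=; exact: cf.
Qed.

Lemma measurable_int_below f : mu.-integrable D (EFin \o f) ->
  measurable_fun D (int_below f).
Proof.
by move=> intf; apply: measurable_continuous_halfline => x; exact: continuous_int_below.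
Qed.

Lemma int_aboveE f (x : R) : mu.-integrable D (EFin \o f) -> 0 < x ->
  int_above f x = \int[mu]_(t in D) f t - int_below f x.
Proof. by move=> intf x0; rewrite -(int_belowDabove intf x0) addrC addKr. Qed.

Lemma continuous_int_above f (x : R) : mu.-integrable D (EFin \o f) -> 0 < x ->
  {for x, continuous (int_above f)}.
Proof.
move=> intf x0; rewrite /prop_for /continuous_at int_aboveE//.
apply: cvg_trans (cvgB (cvg_cst (\int[mu]_(t in D) f t)) (continuous_int_below intf x0)).
apply: near_eq_cvg; near=> y; rewrite int_aboveE//.
by near: y; exact: lt_nbhsr.
Unshelve. all: by end_near. Qed.

Lemma measurable_int_above f : mu.-integrable D (EFin \o f) ->
  measurable_fun D (int_above f).
Proof.
by move=> intf; apply: measurable_continuous_halfline => x; exact: continuous_int_above.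
Qed.

Lemma derive_int_below f (x : R) : mu.-integrable D (EFin \o f) -> 0 < x ->
  {for x, continuous f} ->
  derivable (int_below f) x 1 /\ derive1 (int_below f) x = f x.
Proof.
move=> intf x0 cf; apply: (@continuous_FTC1 _ _ _ _ (x + 1)) => //.
- by rewrite ltrDl.
- exact: integrable_itv0.
Qed.

Lemma le_int_below f (x : R) : mu.-integrable D (EFin \o f) ->
  `|int_below f x| <= \int[mu]_(t in D) `|f t|.
Proof.
move=> intf; apply: le_trans (le_normr_Rintegral _ _) _ => //; first exact: integrable_itv0.
rewrite /Rintegral fine_le//.
- by apply: integrable_fin_num => //; apply: integrable_itv0; exact: integrable_norm.
- by apply: integrable_fin_num => //; exact: integrable_norm.
- apply: ge0_subset_integral => //; last exact: subset_itv0_halfline.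
  by apply: (measurable_int mu); exact: integrable_norm.
Qed.

Lemma le_int_above f (x : R) : mu.-integrable D (EFin \o f) -> 0 < x ->
  `|int_above f x| <= \int[mu]_(t in D) `|f t|.
Proof.
move=> intf x0; have sD : `]x, +oo[ `<=` D.
  by move=> y /=; rewrite in_itv/= andbT; exact: lt_trans.
have ix : forall g, mu.-integrable D (EFin \o g) -> mu.-integrable `]x, +oo[ (EFin \o g).
  by move=> g; apply: integrableS.
apply: le_trans (le_normr_Rintegral _ _) _ => //; first exact: ix.
rewrite /Rintegral fine_le//.
- by apply: integrable_fin_num => //; apply: ix; exact: integrable_norm.
- by apply: integrable_fin_num => //; exact: integrable_norm.
- apply: ge0_subset_integral => //.
  by apply: (measurable_int mu); exact: integrable_norm.
Qed.

Lemma zero_derive_halfline f (x y : R) :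
  (forall z : R, 0 < z -> derivable f z 1) ->
  (forall z : R, 0 < z -> derive1 f z = 0) -> 0 < x -> 0 < y -> f x = f y.
Proof.
move=> df f0; wlog xy : x y / x <= y.
  by move=> h x0 y0; have [/h->//|/ltW/h<-//] := leP x y.
move=> x0 y0.
have z0 z : x <= z -> 0 < z by exact: lt_le_trans.
have [|//|] := @MVT_segment _ f (derive1 f) x y xy.
- move=> z; rewrite in_itv/= => /andP[/ltW/z0 {}z0 _].
  by apply: DeriveDef; [exact: df|rewrite derive1E].
- apply: derivable_within_continuous => z; rewrite in_itv/= => /andP[/z0 {}z0 _].
  exact: df.
move=> c; rewrite in_itv/= => /andP[/z0 {}z0 _].
by rewrite f0// mul0r => /eqP; rewrite subr_eq0 => /eqP.
Qed.

(** Both sides have derivative [f], so they differ by a constant, which is read off at 0+ where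
    [int_below] tends to 0. The limit [l] replaces an endpoint value of [F]. *)
Lemma int_below_primitive f F (l x : R) : mu.-integrable D (EFin \o f) ->
  (forall z : R, 0 < z -> {for z, continuous f}) ->
  (forall z : R, 0 < z -> derivable F z 1) ->
  (forall z : R, 0 < z -> derive1 F z = f z) ->
  F y @[y --> 0^'+] --> l -> 0 < x -> int_below f x = F x - l.
Proof.
move=> intf cf dF F' Fl x0.
pose H y := int_below f y - F y.
have Hc (y : R) : 0 < y -> H y = H x.
  move=> y0; apply: (zero_derive_halfline _ _ y0 x0) => z z0.
    by apply: derivableB; [exact: (derive_int_below intf z0 (cf _ z0)).1|exact: dF].
  have [d1 d2] := derive_int_below intf z0 (cf _ z0).
  rewrite derive1E (deriveB d1 (dF _ z0)).
  by rewrite -!derive1E d2 F'// subrr.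
have Hl : H y @[y --> 0^'+] --> 0 - l by apply: cvgB => //; exact: int_below_cvg0.
have Hx : H y @[y --> 0^'+] --> H x.
  by apply: cvg_near_cst; near=> y; rewrite Hc.
have /eqP : H x = 0 - l by apply: (cvg_unique (@Rhausdorff R) Hx Hl).
by rewrite sub0r subr_eq addrC => /eqP.
Unshelve. all: by end_near. Qed.

Lemma int_above_primitive f F (l x : R) : mu.-integrable D (EFin \o f) ->
  (forall z : R, 0 < z -> {for z, continuous f}) ->
  (forall z : R, 0 < z -> derivable F z 1) ->
  (forall z : R, 0 < z -> derive1 F z = f z) ->
  F y @[y --> 0^'+] --> l ->
  (\forall z \near +oo, f z = 0 /\ F z = 0) -> 0 < x ->
  int_above f x = - F x /\ \int[mu]_(t in D) f t = - l.
Proof.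
move=> intf cf dF F' Fl [M [_ zM]] x0.
have If : \int[mu]_(t in D) f t = - l.
  (* A positive point beyond [M]: there [F] vanishes and the rest of the integral is zero. *)
  pose y := Num.max M 0 + 1.
  have y0 : 0 < y by rewrite ltr_wpDl// le_max lexx orbT.
  have My : M < y by rewrite ltr_pwDr// le_max lexx.
  rewrite -(int_belowDabove intf y0).
  rewrite (int_below_primitive intf cf dF F' Fl)// (zM _ My).2 sub0r.
  rewrite /int_above (@eq_Rintegral _ _ _ _ _ (fun=> 0)).
    by rewrite /Rintegral integral0 addr0.
  by move=> z; rewrite inE/= in_itv/= andbT => yz; rewrite (zM _ (lt_trans My yz)).1.
split => //; rewrite int_aboveE// If (int_below_primitive intf cf dF F' Fl)//.
by ring.
Qed.

(** Interchange of integrations over the triangle x < y; the symmetry of the Green operator rests on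
    it. *)
Lemma Fubini_halfline a b :
  mu.-integrable D (EFin \o a) -> mu.-integrable D (EFin \o b) ->
  \int[mu]_(x in D) (a x * int_above b x) = \int[mu]_(y in D) (b y * int_below a y).
Proof.
move=> inta intb.
have intA : mu.-integrable setT (EFin \o (a \_ D)).
  by rewrite -restrict_EFin -integrable_mkcond.
have intB : mu.-integrable setT (EFin \o (b \_ D)).
  by rewrite -restrict_EFin -integrable_mkcond.
pose A := a \_ D; pose B := b \_ D.
have mA : measurable_fun setT A by apply/measurable_EFinP; exact: measurable_int intA.
have mB : measurable_fun setT B by apply/measurable_EFinP; exact: measurable_int intB.
pose F (z : R * R) : R := if z.1 < z.2 then A z.1 * B z.2 else 0.
have mF : measurable_fun setT F.
  apply: measurable_fun_ifT => //; first exact: measurable_fun_ltr.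
  by apply: measurable_funM; apply: measurableT_comp.
have mFE : measurable_fun setT (EFin \o F) by exact/measurable_EFinP.
have intF : ((mu \x mu).-integrable setT (EFin \o F))%E.
  apply/integrable12ltyP => //.
  have /integrableP[_ nA] := intA; have /integrableP[mBE nB] := intB.
  (* Dropping the restriction x < y bounds the double integral by a product of two finite
     integrals. *)
  apply: (@le_lt_trans _ _ (\int[mu]_x (`|(A x)%:E| * \int[mu]_y `|(B y)%:E|))%E).
    apply: ge0_le_integral => //.
    - by move=> x _; exact: integral_ge0.
    - apply: (@measurable_fun_fubini_tonelli_F _ _ _ _ _ mu (abse \o (EFin \o F))) => //.
        exact: measurableT_comp.
      by move=> z; rewrite /= lee_fin.
    - apply: emeasurable_funM => //; apply: measurableT_comp => //.
      exact/measurable_EFinP.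
    - move=> x _; rewrite -ge0_integralZl//; last exact: measurableT_comp.
      apply: ge0_le_integral => //.
      + apply: measurableT_comp => //; apply/measurable_EFinP.
        exact: (measurableT_comp mF).
      + apply: emeasurable_funM => //; exact: measurableT_comp.
      + move=> y _; rewrite /F /= -?EFinM lee_fin; case: ifP => _;
          by rewrite ?normrM ?normr0 ?mulr_ge0.
  rewrite [X in (X < _)%E](_ : _ =
      ((\int[mu]_x `|(A x)%:E|) * \int[mu]_y `|(B y)%:E|)%E); last first.
    apply: ge0_integralZr => //; last exact: integral_ge0.
    by apply: measurableT_comp => //; exact/measurable_EFinP.
  by rewrite lte_mul_pinfty// ?integral_ge0// ge0_fin_numE// integral_ge0.
have fubx x : (\int[mu]_y (F (x, y))%:E = (A x * int_above B x)%:E)%E.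
  transitivity (\int[mu]_(y in `]x, +oo[) (A x * B y)%:E)%E.
    rewrite [RHS]integral_mkcond; apply: eq_integral => y _; rewrite patchE /F/=.
    case: ifPn => [xy|xy]; first by rewrite ifT// inE/= in_itv/= xy.
    by rewrite ifF//; apply/negbTE; rewrite notin_setE/= in_itv/= andbT; exact/negP.
  have iB : mu.-integrable `]x, +oo[ (EFin \o B) by apply: (integrableS _ _ _ intB).
  rewrite EFinM /int_above /Rintegral fineK ?integrable_fin_num//.
  by rewrite -integralZl//.
have fuby y : (\int[mu]_x (F (x, y))%:E =
    (B y * \int[mu]_(x in `]-oo, y[) A x)%:E)%E.
  transitivity (\int[mu]_(x in `]-oo, y[) (B y * A x)%:E)%E.
    rewrite [RHS]integral_mkcond; apply: eq_integral => x _; rewrite patchE /F/=.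
    case: ifPn => [xy|xy]; first by rewrite ifT ?(mulrC (A x))// inE/= in_itv/= xy.
    by rewrite ifF//; apply/negbTE; rewrite notin_setE/= in_itv/=; exact/negP.
  have iA : mu.-integrable `]-oo, y[ (EFin \o A) by apply: (integrableS _ _ _ intA).
  rewrite EFinM /Rintegral fineK ?integrable_fin_num//.
  by rewrite -integralZl//.
have := Fubini intF.
under eq_integral do rewrite /= fubx.
under [in X in _ = X -> _]eq_integral do rewrite /= fuby.
move=> /(congr1 fine) h; rewrite [LHS]Rintegral_mkcond [RHS]Rintegral_mkcond.
rewrite [LHS](_ : _ = \int[mu]_x (A x * int_above B x)).
  rewrite {}/Rintegral h; congr fine; apply: eq_integral => y _; rewrite !patchE.
  case: ifPn => yD; last by rewrite /B patchE (negbTE yD) mul0r.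
  congr (_ * _)%:E; first by rewrite /B patchE yD.
  (* The strict inequality x < y yields the open interval []0, y[]; closing it at y adds a null
     set. *)
  rewrite /A -Rintegral_mkcondr /int_below -Rintegral_itv_bndo_bndc.
    congr Rintegral; apply/seteqP; split => x /=; rewrite !in_itv/=.
      by move=> [-> ->].
    by move=> /andP[].
  exact: integrable_itv0.
apply: eq_Rintegral => x _; rewrite !patchE.
case: ifPn => xD; last by rewrite /A patchE (negbTE xD) mul0r.
congr (_ * _); first by rewrite /A patchE xD.
rewrite /int_above /B -Rintegral_mkcondr.
congr Rintegral; apply/seteqP; split => y /=; rewrite !in_itv/= ?andbT.
  by move=> xy; split => //; apply: lt_trans xy; move: xD; rewrite inE.
by move=> [].
Qed.

End Primitive.

(** * The Green operator on L^2 *)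

Section GreenOperator.
Context {R : realType}.
Implicit Types f g : R -> R.
Notation mu := (@lebesgue_measure R).
Notation D := (@halfline R).
Let mD : measurable D := measurable_halfline.
Hint Resolve mD : core.

Lemma rnorm_le f g : real_L2 f -> real_L2 g ->
  (forall x, 0 < x -> `|f x| <= `|g x|) -> rnorm f <= rnorm g.
Proof.
move=> Lf Lg fg; apply: ler_wsqrtr; apply: le_Rintegral => //; try exact: real_L2M.
move=> x x0; rewrite -!expr2 -(real_normK (num_real (f x))) -(real_normK (num_real (g x))).
by rewrite lerXn2r ?nnegrE// fg.
Qed.

Lemma real_L2_norm f : real_L2 f -> real_L2 (fun x => `|f x|).
Proof.
move=> Lf; apply: (real_L2_le _ Lf); last by move=> x _; rewrite normr_id.
by apply: measurableT_comp => //; exact: Lf.1.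
Qed.

Lemma rnorm_norm f : real_L2 f -> rnorm (fun x => `|f x|) = rnorm f.
Proof.
move=> Lf; apply/eqP; rewrite eq_le !rnorm_le//; try exact: real_L2_norm.
all: by move=> x _; rewrite normr_id.
Qed.

Lemma integral_normM_le f g : real_L2 f -> real_L2 g ->
  \int[mu]_(t in D) `|f t * g t| <= rnorm f * rnorm g.
Proof.
move=> Lf Lg; under eq_Rintegral do rewrite normrM.
have := rdot_norm (real_L2_norm Lf) (real_L2_norm Lg); rewrite !rnorm_norm//.
by apply: le_trans; exact: ler_norm.
Qed.

Variables phi theta : R -> R.
Hypotheses (phi_L2 : real_L2 phi) (theta_L2 : real_L2 theta).

(** The integral operator with the symmetric kernel $\phi(\min(x,t))\,\theta(\max(x,t))$. *)
Definition green f x : R :=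
  theta x * int_below (fun t => phi t * f t) x +
  phi x * int_above (fun t => theta t * f t) x.

(** By Cauchy-Schwarz the inner integral is bounded uniformly in x, so the term is dominated by a
    multiple of [theta], itself square-integrable. *)
Lemma green_term_below f : real_L2 f ->
  real_L2 (fun x => theta x * int_below (fun t => phi t * f t) x) /\
  rnorm (fun x => theta x * int_below (fun t => phi t * f t) x) <=
    rnorm phi * rnorm theta * rnorm f.
Proof.
move=> Lf; have intf := real_L2M phi_L2 Lf.
have bnd x : 0 < x -> `|theta x * int_below (fun t => phi t * f t) x| <=
    `|rnorm phi * rnorm f * theta x|.
  move=> x0; rewrite normrM [leRHS]normrM (@ger0_norm _ (_ * _)) ?mulr_ge0 ?rnorm_ge0//.
  rewrite mulrC ler_wpM2r//.
  by apply: le_trans (le_int_below _ intf) _; exact: integral_normM_le.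
have L : real_L2 (fun x => theta x * int_below (fun t => phi t * f t) x).
  apply: real_L2_le bnd; last exact: real_L2Z.
  by apply: measurable_funM; [exact: theta_L2.1|exact: measurable_int_below].
split => //; apply: le_trans (rnorm_le L _ bnd) _; first exact: real_L2Z.
by rewrite rnormZ// ger0_norm ?mulr_ge0 ?rnorm_ge0// mulrAC.
Qed.

Lemma green_term_above f : real_L2 f ->
  real_L2 (fun x => phi x * int_above (fun t => theta t * f t) x) /\
  rnorm (fun x => phi x * int_above (fun t => theta t * f t) x) <=
    rnorm phi * rnorm theta * rnorm f.
Proof.
move=> Lf; have intf := real_L2M theta_L2 Lf.
have bnd x : 0 < x -> `|phi x * int_above (fun t => theta t * f t) x| <=
    `|rnorm theta * rnorm f * phi x|.
  move=> x0; rewrite normrM [leRHS]normrM (@ger0_norm _ (_ * _)) ?mulr_ge0 ?rnorm_ge0//.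
  rewrite mulrC ler_wpM2r//.
  by apply: le_trans (le_int_above intf x0) _; exact: integral_normM_le.
have L : real_L2 (fun x => phi x * int_above (fun t => theta t * f t) x).
  apply: real_L2_le bnd; last exact: real_L2Z.
  by apply: measurable_funM; [exact: phi_L2.1|exact: measurable_int_above].
split => //; apply: le_trans (rnorm_le L _ bnd) _; first exact: real_L2Z.
by rewrite rnormZ// ger0_norm ?mulr_ge0 ?rnorm_ge0// mulrAC (mulrC (rnorm theta)).
Qed.

Lemma green_L2 f : real_L2 f -> real_L2 (green f).
Proof.
move=> Lf.
by apply: real_L2D; [exact: (green_term_below Lf).1|exact: (green_term_above Lf).1].
Qed.

Lemma rnorm_green f : real_L2 f ->
  rnorm (green f) <= 2 * (rnorm phi * rnorm theta) * rnorm f.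
Proof.
move=> Lf; have [Lb nb] := green_term_below Lf; have [La na] := green_term_above Lf.
apply: le_trans (rnorm_triangle Lb La) _; apply: le_trans (lerD nb na) _.
by rewrite -mulr2n -[_ *+ 2]mulr_natl !mulrA.
Qed.

Lemma green_lin (c : R) f g x : real_L2 f -> real_L2 g -> 0 < x ->
  green (fun t => c * f t + g t) x = c * green f x + green g x.
Proof.
move=> Lf Lg x0; rewrite /green.
have sD : `]x, +oo[ `<=` D.
  by move=> y /=; rewrite in_itv/= andbT; exact: lt_trans.
have lin (E : set R) h : measurable E -> E `<=` D -> real_L2 h ->
    \int[mu]_(t in E) (h t * (c * f t + g t)) =
    c * (\int[mu]_(t in E) (h t * f t)) + \int[mu]_(t in E) (h t * g t).
  move=> mE ED Lh.
  have iE k : real_L2 k -> mu.-integrable E (EFin \o (fun t => h t * k t)).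
    by move=> Lk; apply: integrableS (real_L2M Lh Lk).
  rewrite -RintegralZl//; last exact: iE.
  rewrite -RintegralD//; last exact: iE.
    by apply: eq_Rintegral => t _; ring.
  rewrite (_ : _ \o _ = (fun t => c%:E * (EFin \o (fun t => h t * f t)%R) t)%E)//.
  by apply: integrableZl => //; exact: iE.
rewrite /int_below /int_above !lin//; [by ring|exact: subset_itv0_halfline].
Qed.

Lemma rnorm_greenB f g : real_L2 f -> real_L2 g ->
  rnorm (fun x => green f x - green g x) <=
  2 * (rnorm phi * rnorm theta) * rnorm (fun x => f x - g x).
Proof.
move=> Lf Lg; have Lfg := real_L2B Lf Lg.
apply: le_trans (rnorm_green Lfg).
apply: rnorm_le; [|exact: green_L2|].
  by apply: real_L2B; exact: green_L2.
move=> x x0; have := green_lin (-1) Lg Lf x0.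
under [X in green X]eq_fun do rewrite mulN1r addrC.
by move=> ->; rewrite mulN1r addrC.
Qed.

(** Integration forgets null sets, so the values agree at every point and not merely almost
    everywhere. *)
Lemma green_ae f g x : real_L2 f -> real_L2 g -> ae_eq mu D f g -> 0 < x ->
  green f x = green g x.
Proof.
move=> Lf Lg fg x0; rewrite /green /int_below /int_above /Rintegral.
have sD : `]x, +oo[ `<=` D.
  by move=> y /=; rewrite in_itv/= andbT; exact: lt_trans.
have aeE (E : set R) h : measurable E -> E `<=` D -> real_L2 h ->
    (\int[mu]_(t in E) (h t * f t)%:E = \int[mu]_(t in E) (h t * g t)%:E)%E.
  move=> mE ED Lh.
  have iE k : real_L2 k -> measurable_fun E (EFin \o (fun t => h t * k t)).
    move=> Lk; apply: (measurable_int mu).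
    by apply: integrableS (real_L2M Lh Lk).
  apply: ae_eq_integral; [by []|exact: iE|exact: iE|].
  by apply: filterS fg => y fgy /ED Dy; rewrite fgy.
by rewrite !aeE//; exact: subset_itv0_halfline.
Qed.

Lemma green_sym f g : real_L2 f -> real_L2 g ->
  rdot (green f) g = rdot f (green g).
Proof.
move=> Lf Lg.
(* Interchanging the integrations turns the upper term for one function into the lower term for the
   other; the two terms of [green] thus swap roles. *)
have half h k : real_L2 h -> real_L2 k ->
    rdot (fun x => phi x * int_above (fun t => theta t * h t) x) k =
    rdot (fun x => theta x * int_below (fun t => phi t * k t) x) h.
  move=> Lh Lk; rewrite /rdot.
  have := Fubini_halfline (real_L2M phi_L2 Lk) (real_L2M theta_L2 Lh).
  under eq_Rintegral do rewrite mulrAC; move=> ->.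
  by under eq_Rintegral do rewrite mulrAC.
rewrite rdotDl//; try exact: (green_term_below _).1; try exact: (green_term_above _).1.
rewrite [RHS]rdotC rdotDl//; try exact: (green_term_below _).1; try exact: (green_term_above _).1.
by rewrite !half// addrC.
Qed.

End GreenOperator.

(** * Density of compactly supported functions of class C^2 *)

Section Density.
Context {R : realType}.
Implicit Types f g : R -> R.
Notation mu := (@lebesgue_measure R).
Notation D := (@halfline R).
Let mD : measurable D := measurable_halfline.
Hint Resolve mD : core.

(** Dominated convergence for the squares $(f-f_n)^2$, with majorant $g^2$. A single index is
    extracted, which is what a density argument consumes. *)
Lemma rnorm_dominated (f_ : nat -> R -> R) f g :
  (forall n, measurable_fun D (f_ n)) -> measurable_fun D f -> real_L2 g ->
  {ae mu, forall x, D x -> f_ ^~ x @ \oo --> f x} ->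
  (forall n x, 0 < x -> `|f_ n x - f x| <= g x) ->
  forall e : R, 0 < e -> exists n, rnorm (fun x => f x - f_ n x) < e.
Proof.
move=> mf_ mf Lg f_f bnd e e0.
have md n : measurable_fun D (fun x => f x - f_ n x) by exact: measurable_funB.
have Ld n : real_L2 (fun x => f x - f_ n x).
  apply: real_L2_le Lg _ => // x x0; rewrite distrC.
  by apply: le_trans (bnd n _ x0) _; exact: ler_norm.
have [] := @dominated_convergence _ _ _ mu D mD
  (fun n => EFin \o (fun x => (f x - f_ n x) ^+ 2)) (cst 0%E)
  (EFin \o (fun x => g x ^+ 2)).
- by move=> n; apply/measurable_EFinP; apply: measurable_funX; exact: md.
- exact: measurable_cst.
- move: f_f; apply: filterS; first exact: (ae_filter_ringOfSetsType mu).
  move=> x + Dx => /(_ Dx) fx.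
  have h0 : f x - f_ n x @[n --> \oo] --> 0.
    by rewrite -(subrr (f x)); apply: cvgB => //; exact: cvg_cst.
  apply/fine_cvgP; split; first exact: nearW.
  rewrite /= -[X in _ --> X](mulr0 0).
  by under eq_cvg do rewrite /= expr2; exact: cvgM.
- exact: Lg.2.
- apply: aeW => x n Dx /=; rewrite lee_fin ger0_norm ?sqr_ge0//.
  have := bnd n x Dx; rewrite distrC => h.
  rewrite -(real_normK (num_real _)) lerXn2r ?nnegrE//.
  exact: le_trans h.
move=> _ _; rewrite integral0 => /fine_cvgP[_] /=.
move/cvgrPdist_lt => /(_ (e ^+ 2)); rewrite exprn_gt0// => /(_ isT)[n _ /(_ n)].
rewrite /= leqnn => /(_ isT) /=; rewrite sub0r normrN => hn; exists n.
rewrite -ltr_sqr ?nnegrE ?rnorm_ge0 ?(ltW e0)// rnorm2.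
apply: le_lt_trans hn; apply: le_trans (ler_norm _).
by rewrite /rdot /Rintegral.
Qed.

Definition supported_in (a b : R) f := forall x, x < a \/ b < x -> f x = 0.

(** The clause [0 < a] keeps the support away from 0, so each of the boundary conditions holds
    trivially. *)
Definition bounded_supported f : Prop :=
  [/\ measurable_fun setT f, (exists M, forall x, `|f x| <= M) &
      exists a b, 0 < a /\ supported_in a b f].

Lemma real_L2_indic (c a b : R) : real_L2 (fun x => c * \1_(`[a, b]) x).
Proof.
apply: real_L2Z; split; first exact: measurable_indic.
rewrite (_ : _ \o _ = EFin \o \1_(`[a, b])); last first.
  by apply/funext => x /=; rewrite indicE; case: (_ \in _); rewrite ?expr1n ?expr0n.
apply: (@integrableS _ _ _ mu setT) => //.
by apply: integrable_indic_itv.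
Qed.

Lemma bounded_supported_L2 f : bounded_supported f -> real_L2 f.
Proof.
move=> [mf [M fM] [a [b [a0 sf]]]].
apply: real_L2_le (real_L2_indic M a b) _; first exact: measurable_funS mf.
move=> x _; rewrite indicE; have [xab|] := boolP (x \in _).
  by rewrite mulr1; apply: le_trans (fM x) (ler_norm _).
rewrite notin_setE/= in_itv/= => /negP; rewrite negb_and -!ltNge => /orP h.
by rewrite sf// mulr0.
Qed.

Lemma bounded_supported_integrable f : bounded_supported f ->
  mu.-integrable setT (EFin \o f).
Proof.
move=> [mf [M fM] [a [b [a0 sf]]]].
have ig : mu.-integrable setT (fun x => M%:E * (EFin \o \1_(`[a, b])) x)%E.
  by apply: integrableZl => //; exact: integrable_indic_itv.
apply: le_integrable ig => //; first exact/measurable_EFinP.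
move=> x _ /=; rewrite lee_fin indicE; have [xab|] := boolP (x \in _).
  by rewrite mulr1; apply: le_trans (fM x) (ler_norm _).
rewrite notin_setE/= in_itv/= => /negP; rewrite negb_and -!ltNge => /orP h.
by rewrite sf// mulr0 normr0.
Qed.

Lemma truncation_dense f (e : R) : real_L2 f -> 0 < e ->
  exists2 g, bounded_supported g & rnorm (fun x => f x - g x) < e.
Proof.
move=> Lf e0.
(* Truncation in the variable, at both ends of the half-line, and in the values. *)
pose A n := `[n.+1%:R^-1, n.+1%:R] `&` [set x | `|f x| <= n%:R].
pose f_ n := f \_ (A n).
have AD n : A n `<=` D.
  move=> x [/=]; rewrite in_itv/= => /andP[+ _] _.
  by apply: lt_le_trans; rewrite invr_gt0.
have mA n : measurable (A n).
  have -> : A n = `[n.+1%:R^-1, n.+1%:R] `&` (D `&` (fun x => `|f x|) @^-1` `]-oo, n%:R]).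
    apply/seteqP; split => x /=; rewrite !in_itv/= => -[xn]; last by case.
    split => //; split => //; move: xn => /andP[+ _]; rewrite /halfline/=.
    by rewrite bnd_simp; apply: lt_le_trans; rewrite invr_gt0.
  apply: measurableI => //.
  have mnf : measurable_fun D (fun x => `|f x|) by apply: measurableT_comp => //; exact: Lf.1.
  by apply: mnf.
have mf_ n : measurable_fun setT (f_ n).
  by apply/(measurable_restrictT _ _).1 => //; apply: measurable_funS Lf.1.
have [n nE] : exists n, rnorm (fun x => f x - f_ n x) < e.
  apply: (@rnorm_dominated f_ f (fun x => `|f x|)) => //.
  - by move=> n; apply: measurable_funS (mf_ n).
  - exact: Lf.1.
  - exact: real_L2_norm.
  - apply: aeW => x Dx; apply: cvg_near_cst.
    near=> n; rewrite /f_ patchE ifT// inE; split => /=; last first.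
      by near: n; exact: nbhs_infty_ger.
    have nn1 : (n%:R <= n.+1%:R :> R) by rewrite ler_nat.
    rewrite in_itv/= -[leRHS]invrK lef_pV2 ?posrE ?invr_gt0//; apply/andP; split.
      by apply: le_trans nn1; near: n; exact: nbhs_infty_ger.
    by apply: le_trans nn1; near: n; exact: nbhs_infty_ger.
  - move=> n x x0; rewrite /f_ patchE; case: ifP => _.
      by rewrite subrr normr0.
    by rewrite sub0r normrN.
exists (f_ n) => //; split => //.
  exists n%:R => x; rewrite /f_ patchE; case: ifPn => [|_].
    by rewrite inE => -[].
  by rewrite normr0.
exists n.+1%:R^-1, n.+1%:R; split; first by rewrite invr_gt0.
move=> x h; rewrite /f_ patchE ifF//; apply/negbTE; rewrite notin_setE => -[/= + _].
by rewrite in_itv/= => /andP[? ?]; case: h; rewrite ltNge => /negP.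
Unshelve. all: by end_near. Qed.

Definition primitive f (x : R) : R := \int[mu]_(t in `]-oo, x]) f t.

(** The Steklov average over []x - h, x]]. The window looks backwards, so supports can grow only to
    the right and never towards 0. *)
Definition average (h : R) f (x : R) : R := h^-1 * (primitive f x - primitive f (x - h)).

Lemma primitiveB f (x y : R) : mu.-integrable setT (EFin \o f) -> y <= x ->
  primitive f x - primitive f y = \int[mu]_(t in `]y, x]) f t.
Proof.
move=> intf yx; rewrite /primitive Rintegral_itvB ?bnd_simp//.
exact: integrableS intf.
Qed.

Lemma primitive_lip f (M x y : R) : mu.-integrable setT (EFin \o f) ->
  (forall x, `|f x| <= M) -> y <= x ->
  `|primitive f x - primitive f y| <= M * (x - y).
Proof.
move=> intf fM yx; rewrite primitiveB//.
have intxy : mu.-integrable `]y, x] (EFin \o f) by apply: integrableS intf.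
apply: le_trans (le_normr_Rintegral _ _) _ => //.
have -> : M * (x - y) = \int[mu]_(t in `]y, x]) M.
  rewrite Rintegral_cst// [X in fine X](lebesgue_measure_itv `]y, x])/= lte_fin.
  by have [//|] := ltP y x; move=> xy; rewrite (@le_anti _ _ x y) ?xy//= subrr.
apply: le_Rintegral => //; first exact: integrable_norm.
apply: measurable_bounded_integrable => //.
  by rewrite [X in (X < _)%E](lebesgue_measure_itv `]y, x])/=;
    case: ifP => _ //; rewrite -EFinB ltry.
by exists `|M|; split; [exact: num_real|move=> K MK z _; exact: ltW].
Qed.

Lemma primitive_continuous f : bounded_supported f -> continuous (primitive f).
Proof.
move=> bf x; have intf := bounded_supported_integrable bf.
have [_ [M fM] _] := bf.
have lip y z : `|primitive f y - primitive f z| <= M * `|y - z|.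
  wlog zy : y z / z <= y.
    by move=> h; have [/h//|/ltW/h] := leP z y; rewrite distrC (distrC y).
  by rewrite (@ger0_norm _ (y - z)) ?subr_ge0//; exact: primitive_lip.
have M0 : 0 <= M by exact: le_trans (fM 0).
apply/cvgrPdist_lt => e e0; near=> y.
apply: le_lt_trans (lip _ _) _.
apply: (@le_lt_trans _ _ ((M + 1) * `|x - y|)); first by rewrite ler_wpM2r ?lerDl.
rewrite mulrC -ltr_pdivlMr ?ltr_wpDl//.
near: y; apply/nbhs_ballP; exists (e / (M + 1)) => //=.
by rewrite divr_gt0 ?ltr_wpDl.
Unshelve. all: by end_near. Qed.

Lemma average_le (h M : R) f : 0 < h -> mu.-integrable setT (EFin \o f) ->
  (forall x, `|f x| <= M) -> forall x, `|average h f x| <= M.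
Proof.
move=> h0 intf fM x; have xh : x - h <= x by rewrite gerBl ltW.
rewrite /average normrM gtr0_norm ?invr_gt0// mulrC ler_pdivrMr//.
apply: le_trans (primitive_lip intf fM xh) _.
by rewrite opprB addrC subrK.
Qed.

Lemma supported_in_average (h a b : R) f : 0 < h <= 1 ->
  mu.-integrable setT (EFin \o f) -> supported_in a b f ->
  supported_in a (b + 1) (average h f).
Proof.
move=> /andP[h0 h1] intf sf x xab; have xh : x - h <= x by rewrite gerBl ltW.
rewrite /average primitiveB//.
rewrite (@eq_Rintegral _ _ _ _ _ (fun=> 0)); first by rewrite /Rintegral integral0 mulr0.
move=> t; rewrite inE/= in_itv/= => /andP[t1 t2]; apply: sf.
case: xab => xab; [left; exact: le_lt_trans xab|right; lra].
Qed.

Lemma average_continuous (h : R) f : bounded_supported f ->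
  continuous (average h f).
Proof.
move=> bf x; apply: cvgM; first exact: cvg_cst.
apply: cvgB; first exact: primitive_continuous.
apply: continuous_cvg; first exact: primitive_continuous.
by apply: cvgB; [exact: cvg_id|exact: cvg_cst].
Qed.

Lemma average_bounded_supported (h : R) f : 0 < h <= 1 -> bounded_supported f ->
  bounded_supported (average h f).
Proof.
move=> h01 bf; have intf := bounded_supported_integrable bf.
have [_ [M fM] [a [b [a0 sf]]]] := bf.
split; first by apply: continuous_measurable_fun; exact: average_continuous.
  by exists M; apply: average_le => //; case/andP: h01.
by exists a, (b + 1); split => //; exact: supported_in_average.
Qed.

(** By Lebesgue differentiation the averages converge almost everywhere as h tends to 0; for h at
    most 1 the error is dominated by 2M on [[a, b + 1]]. *)
Lemma average_dense f (e : R) : bounded_supported f -> 0 < e ->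
  exists2 h : R, 0 < h <= 1 & rnorm (fun x => f x - average h f x) < e.
Proof.
move=> bf e0; have intf := bounded_supported_integrable bf.
pose h_ n : R := n.+1%:R^-1.
have h_0 n : 0 < h_ n by rewrite invr_gt0.
have h_01 n : 0 < h_ n <= 1 by rewrite h_0 invf_le1 ?ltr0n// ler1n.
have [mf [M fM] [a [b [a0 sf]]]] := bf.
suff [n ?] : exists n, rnorm (fun x => f x - average (h_ n) f x) < e.
  by exists (h_ n).
apply: (@rnorm_dominated _ _ (fun x => (2 * M) * \1_(`[a, b + 1]) x)) => //.
- move=> n; have [mav _ _] := average_bounded_supported (h_01 n) bf.
  exact: measurable_funS mav.
- exact: measurable_funS mf.
- exact: real_L2_indic.
- have locf : locally_integrable setT f by apply: open_integrable_locally => //; exact: openT.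
  have intNy y : mu.-integrable `]-oo, y] (EFin \o f) by apply: integrableS intf.
  have := FTC1Ny intNy locf.
  apply: filterS; first exact: (ae_filter_ringOfSetsType mu).
  move=> x [dF F'x] _.
  move: dF F'x; rewrite derive1E => dF F'x.
  have : h^-1 *: (primitive f (h *: 1 + x) - primitive f x) @[h --> 0^'] --> f x.
    by rewrite -F'x; exact: dF.
  (* A backward average is the difference quotient of the primitive at the negative increment
     [- h_ n]. *)
  move=> /cvgr_dnbhsP /(_ (fun n => - h_ n)).
  have : (forall n, - h_ n != 0) /\ - h_ n @[n --> \oo] --> 0.
    split; first by move=> n; rewrite oppr_eq0 gt_eqF.
    by rewrite -[X in _ --> X]oppr0; apply: cvgN; exact: cvg_harmonic.
  move=> h0 /(_ h0); apply: cvg_trans; apply: near_eq_cvg; apply: nearW => n.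
  rewrite /average /= invrN scaleNr -scalerN opprB.
  by congr (_ *: (_ - primitive f _)); rewrite [_ *: 1]mulr1 addrC.
- move=> n x x0; rewrite indicE; have [xab|] := boolP (x \in _).
    rewrite mulr1; apply: le_trans (ler_normB _ _) _.
    by rewrite mulr_natl mulr2n lerD//; exact: average_le.
  rewrite notin_setE/= in_itv/= => /negP; rewrite negb_and -!ltNge => /orP h.
  rewrite (supported_in_average (h_01 n) intf sf)// sf ?subrr ?normr0 ?mulr0//.
  by case: h => h; [left|right => //; lra].
Qed.

Lemma is_derive_shift f (x h d : R) : is_derive (x - h) 1 f d ->
  is_derive x 1 (fun y => f (y - h)) d.
Proof.
move=> df; rewrite -(mulr1 d).
apply: (@is_derive1_comp _ f (fun y => y - h)) => //.
by rewrite -[X in is_derive _ _ _ X]subr0; apply: is_deriveB.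
Qed.

Lemma average_derive (h : R) f : bounded_supported f -> continuous f ->
  forall x : R, is_derive x 1 (average h f) (h^-1 * (f x - f (x - h))).
Proof.
move=> bf cf x; have intf := bounded_supported_integrable bf.
have dP (y : R) : is_derive y 1 (primitive f) (f y).
  have [||||dp p'] := @continuous_FTC1 _ f -oo%O y (y + 1).
  - by rewrite ltrDl.
  - exact: integrableS intf.
  - exact: ltNyr.
  - exact: cf.
  by apply: DeriveDef; [exact: dp|rewrite -derive1E].
have dS : is_derive x 1 (fun y => primitive f (y - h)) (f (x - h)).
  exact: is_derive_shift.
have := is_deriveZ h^-1 (is_deriveB (dP x) dS).
by apply.
Qed.

(** One truncation and three averages: the first average makes the function continuous, the next two
    add one derivative each. Every one of the four operations costs at most e/4. *)
Lemma real_L2_dense f (e : R) : real_L2 f -> 0 < e ->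
  exists g, [/\ bounded_supported g, Ck 2 g & rnorm (fun x => f x - g x) < e].
Proof.
move=> Lf e0; have e4 : 0 < e / 4 by rewrite divr_gt0.
have [g0 bg0 n0] := truncation_dense Lf e4.
have [h1 h1P n1] := average_dense bg0 e4.
have bg1 := average_bounded_supported h1P bg0.
have cg1 := @average_continuous h1 _ bg0.
set g1 := average h1 g0 in n1 bg1 cg1.
have [h2 h2P n2] := average_dense bg1 e4.
have bg2 := average_bounded_supported h2P bg1.
have dg2 := @average_derive h2 _ bg1 cg1.
have cg2 := @average_continuous h2 _ bg1.
set g2 := average h2 g1 in n2 bg2 dg2 cg2.
have [h3 h3P n3] := average_dense bg2 e4.
have bg3 := average_bounded_supported h3P bg2.
have dg3 := @average_derive h3 _ bg2 cg2.
set g3 := average h3 g2 in n3 bg3 dg3.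
exists g3; split => //; last first.
  have [L0 L1 L2 L3] := And4 (bounded_supported_L2 bg0) (bounded_supported_L2 bg1)
    (bounded_supported_L2 bg2) (bounded_supported_L2 bg3).
  have tri k u v w : real_L2 u -> real_L2 v -> real_L2 w ->
      rnorm (fun x => u x - v x) < k -> rnorm (fun x => v x - w x) < e / 4 ->
      rnorm (fun x => u x - w x) < k + e / 4.
    move=> Lu Lv Lw h h'.
    apply: le_lt_trans (ltrD h h');
    apply: le_trans (rnorm_triangle (real_L2B Lu Lv) (real_L2B Lv Lw)).
    by under [X in _ <= rnorm X]eq_fun do rewrite subrKA.
  have := tri _ _ _ _ Lf L2 L3 (tri _ _ _ _ Lf L1 L2 (tri _ _ _ _ Lf L0 L1 n0 n1) n2) n3.
  by have -> : e / 4 + e / 4 + e / 4 + e / 4 = e by field.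
have d1g3 : derive1 g3 = fun x => h3^-1 * (g2 x - g2 (x - h3)).
  by apply/funext => x; rewrite derive1E derive_val.
have d2g3 (x : R) : is_derive x 1 (derive1 g3)
    (h3^-1 * (h2^-1 * (g1 x - g1 (x - h2)) - h2^-1 * (g1 (x - h3) - g1 (x - h3 - h2)))).
  rewrite d1g3; have := is_deriveZ h3^-1 (is_deriveB (dg2 x) (is_derive_shift (dg2 (x - h3)))).
  by apply.
have cs h : continuous (fun x => g1 (x - h)).
  move=> x; apply: continuous_cvg; first exact: cg1.
  by apply: cvgB; [exact: cvg_id|exact: cvg_cst].
split.
  move=> [|[|//]] x _ x0 /=; first by case: (dg3 x).
  by case: (d2g3 x).
move=> x x0.
have -> : derive1n 2 g3 = fun x => (h3^-1 *
    (h2^-1 * (g1 x - g1 (x - h2)) - h2^-1 * (g1 (x - h3) - g1 (x - h3 - h2)))).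
  by apply/funext => y /=; rewrite /derive1n/= derive1E derive_val.
have c3 y : {for y, continuous (fun x => g1 (x - h3 - h2))}.
  have -> : (fun x => g1 (x - h3 - h2)) = (fun x => g1 (x - (h3 + h2))).
    by apply/funext => z; congr g1; ring.
  exact: cs.
apply: cvgM; first exact: cvg_cst.
apply: cvgB; (apply: cvgM; first exact: cvg_cst).
  by apply: cvgB; [exact: cg1|exact: cs].
by apply: cvgB; [exact: cs|exact: c3].
Qed.

End Density.

(** * Wronskians and Green's formula *)

Section Calculus.
Context {R : realType}.
Implicit Types (f g : R -> R) (x a b : R).

Lemma derivable_is_derive f x : derivable f x 1 -> is_derive x 1 f (derive1 f x).
Proof. by move=> df; apply: DeriveDef => //; rewrite derive1E. Qed.

Lemma is_derive_derive1 f x a : is_derive x 1 f a -> derive1 f x = a.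
Proof. by move=> df; rewrite derive1E derive_val. Qed.

Lemma is_derive_mul f g x a b : is_derive x 1 f a -> is_derive x 1 g b ->
  is_derive x 1 (fun y => f y * g y) (a * g x + f x * b).
Proof.
move=> df dg; have := is_deriveM df dg.
by rewrite (_ : _ *: _ + _ *: _ = a * g x + f x * b)// addrC [X in X + _]mulrC.
Qed.

Lemma is_derive_add f g x a b : is_derive x 1 f a -> is_derive x 1 g b ->
  is_derive x 1 (fun y => f y + g y) (a + b).
Proof. by move=> df dg; exact: is_deriveD. Qed.

Lemma is_derive_sub f g x a b : is_derive x 1 f a -> is_derive x 1 g b ->
  is_derive x 1 (fun y => f y - g y) (a - b).
Proof. by move=> df dg; exact: is_deriveB. Qed.

Lemma is_derive_inv f x a : is_derive x 1 f a -> f x != 0 ->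
  is_derive x 1 (fun y => (f y)^-1) (- a / f x ^+ 2).
Proof.
move=> [df <-] fx; apply: DeriveDef; first exact: derivableV.
by rewrite deriveV// scaleNr mulNr; congr (- _); rewrite [LHS]mulrC.
Qed.

Lemma is_derive_continuous f x a : is_derive x 1 f a -> {for x, continuous f}.
Proof. by move=> [df _]; exact/differentiable_continuous/derivable1_diffP. Qed.

Lemma is_derive_open (A : set R) f g x a : open A -> A x ->
  (forall y, A y -> f y = g y) -> is_derive x 1 f a -> is_derive x 1 g a.
Proof.
move=> oA Ax fg; apply: near_eq_is_derive.
by have := open_nbhs_nbhs (conj oA Ax); apply: filterS => y /fg.
Qed.

Lemma derive1_open (A : set R) f g x : open A -> A x ->
  (forall y, A y -> f y = g y) -> derive1 f x = derive1 g x.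
Proof.
move=> oA Ax fg; rewrite !derive1E; apply: near_eq_derive.
by have := open_nbhs_nbhs (conj oA Ax); apply: filterS => y /fg.
Qed.

Lemma continuous_open (A : set R) f g x : open A -> A x ->
  (forall y, A y -> f y = g y) -> {for x, continuous f} -> {for x, continuous g}.
Proof.
move=> oA Ax fg; rewrite /prop_for /continuous_at -(fg _ Ax).
apply: cvg_trans; apply: near_eq_cvg.
by have := open_nbhs_nbhs (conj oA Ax); apply: filterS => y /fg.
Qed.

End Calculus.

(** * The real Sturm-Liouville expression, Lagrange's identity and variation of constants *)

Section SturmLiouvilleReal.
Context {R : realType}.
Implicit Types (u v f : R -> R) (x y z : R).
Notation mu := (@lebesgue_measure R).
Notation D := (@halfline R).
Variables p q : R -> R.

Definition quasi_derivative u x : R := p x * derive1 u x.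
Notation qd := quasi_derivative.

Definition SLreal u x : R := - derive1 (qd u) x + q x * u x.

Definition SLregular u : Prop :=
  forall x, 0 < x -> derivable u x 1 /\ derivable (qd u) x 1.

(** The Wronskian weighted by p, that is $p(u'v-uv')$. It is written with quasi-derivatives because
    these, rather than u' itself, are assumed differentiable. *)
Definition wronskian u v x : R := qd u x * v x - u x * qd v x.

(** Lagrange's identity: the mixed terms $pu'v'$ cancel, and so do the two terms with q. *)
Lemma is_derive_wronskian u v x : SLregular u -> SLregular v -> 0 < x ->
  is_derive x 1 (wronskian u v) (u x * SLreal v x - SLreal u x * v x).
Proof.
move=> ru rv x0; have [du dpu] := ru _ x0; have [dv dpv] := rv _ x0.
apply: (is_derive_eq (is_derive_sub
  (is_derive_mul (derivable_is_derive dpu) (derivable_is_derive dv))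
  (is_derive_mul (derivable_is_derive du) (derivable_is_derive dpv)))).
rewrite /SLreal /quasi_derivative -/(qd u) -/(qd v).
move: (derive1 (qd u) x) (derive1 (qd v) x) (derive1 u x) (derive1 v x) => *.
by ring.
Qed.

Lemma derive1_qd u x : SLreal u x = 0 -> derive1 (qd u) x = q x * u x.
Proof.
rewrite /SLreal; move: (derive1 (qd u) x) => d /eqP.
by rewrite addrC subr_eq0 => /eqP.
Qed.

Lemma SLreal_open (A : set R) u v x : open A -> A x ->
  (forall y, A y -> u y = v y) -> SLreal u x = SLreal v x.
Proof.
move=> oA Ax uv; rewrite /SLreal (uv _ Ax).
have quv y : A y -> qd u y = qd v y.
  by move=> Ay; rewrite /quasi_derivative (derive1_open oA Ay uv).
by rewrite (derive1_open oA Ax quv).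
Qed.

Variables phi theta : R -> R.
Hypotheses (phi_L2 : real_L2 phi) (theta_L2 : real_L2 theta)
  (phi_reg : SLregular phi) (theta_reg : SLregular theta)
  (phi_eq : forall x, 0 < x -> SLreal phi x = 0)
  (theta_eq : forall x, 0 < x -> SLreal theta x = 0)
  (wronskian1 : forall x, 0 < x -> wronskian phi theta x = 1).

Let phi_cont x : 0 < x -> {for x, continuous phi}.
Proof. by move=> /phi_reg[/derivable_is_derive/is_derive_continuous]. Qed.

Let theta_cont x : 0 < x -> {for x, continuous theta}.
Proof. by move=> /theta_reg[/derivable_is_derive/is_derive_continuous]. Qed.

(** Lagrange's identity integrates to W(phi, u)(x) below x and to -W(theta, u)(x) above x; then
    theta W(phi, u) - phi W(theta, u) = u W(phi, theta) = u. The boundary condition enters as W(phi,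
    u) -> 0 at 0. *)
Lemma green_SLreal u (l : R) : SLregular u ->
  (forall x, 0 < x -> {for x, continuous (SLreal u)}) -> real_L2 (SLreal u) ->
  wronskian phi u x @[x --> 0^'+] --> 0 ->
  wronskian theta u x @[x --> 0^'+] --> l ->
  (\forall x \near +oo, SLreal u x = 0 /\ wronskian theta u x = 0) ->
  forall x, 0 < x -> green phi theta (SLreal u) x = u x.
Proof.
move=> ru cLu Lu Wphi Wtheta uoo x x0.
have cM v z : (forall x, 0 < x -> {for x, continuous v}) -> 0 < z ->
    {for z, continuous (fun t => v t * SLreal u t)}.
  by move=> cv z0; apply: cvgM; [exact: cv|exact: cLu].
have dW v z : SLregular v -> (forall x, 0 < x -> SLreal v x = 0) -> 0 < z ->
    is_derive z 1 (wronskian v u) (v z * SLreal u z).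
  move=> rv ev z0; have := is_derive_wronskian rv ru z0.
  by rewrite ev// mul0r subr0.
rewrite /green.
rewrite (@int_below_primitive _ _ (wronskian phi u) 0)//; last 4 first.
- exact: real_L2M.
- by move=> z; exact: cM.
- by move=> z z0; case: (dW _ _ phi_reg phi_eq z0).
- by move=> z z0; exact: is_derive_derive1 (dW _ _ phi_reg phi_eq z0).
have [] := @int_above_primitive _ (fun t => theta t * SLreal u t) (wronskian theta u) l x.
- exact: real_L2M.
- by move=> z; exact: cM.
- by move=> z z0; case: (dW _ _ theta_reg theta_eq z0).
- by move=> z z0; exact: is_derive_derive1 (dW _ _ theta_reg theta_eq z0).
- exact: Wtheta.
- by apply: filterS uoo => z [-> ->]; rewrite mulr0.
- exact: x0.
move=> -> _; transitivity (u x * wronskian phi theta x).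
  rewrite /wronskian; move: (qd phi x) (qd theta x) (qd u x) => *.
  by ring.
by rewrite wronskian1// mulr1.
Qed.

(** The integral of phi times the expression is the increase of W(phi, u) from 0 to infinity. It is
    used with c = 0 for functions vanishing far out and with c = 1 for the cut-off theta. *)
Lemma rdot_phi_SLreal u (c : R) : SLregular u ->
  (forall x, 0 < x -> {for x, continuous (SLreal u)}) -> real_L2 (SLreal u) ->
  wronskian phi u x @[x --> 0^'+] --> 0 ->
  (\forall x \near +oo, SLreal u x = 0 /\ wronskian phi u x = c) ->
  rdot phi (SLreal u) = c.
Proof.
move=> ru cLu Lu Wphi uoo.
(* Subtracting [c] gives the primitive that vanishes near infinity. *)
have dW z : 0 < z -> is_derive z 1 (fun y => wronskian phi u y - c) (phi z * SLreal u z).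
  move=> z0; rewrite -[X in is_derive _ _ _ X]subr0; apply: is_derive_sub.
  have := is_derive_wronskian phi_reg ru z0.
  by rewrite phi_eq// mul0r subr0.
have [] := @int_above_primitive _ (fun t => phi t * SLreal u t)
  (fun y => wronskian phi u y - c) (0 - c) 1.
- exact: real_L2M.
- by move=> z z0; apply: cvgM; [exact: phi_cont|exact: cLu].
- by move=> z z0; case: (dW _ z0).
- by move=> z z0; exact: is_derive_derive1 (dW _ z0).
- by apply: cvgB => //; exact: cvg_cst.
- by apply: filterS uoo => z [-> ->]; rewrite mulr0 subrr.
- exact: ltr01.
by move=> _; rewrite /rdot sub0r opprK.
Qed.

Section GreenRegular.
Variable f : R -> R.
Hypotheses (f_cont : forall x, 0 < x -> {for x, continuous f}) (f_L2 : real_L2 f).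

Let I := int_below (fun t => phi t * f t).
Let J := int_above (fun t => theta t * f t).

Let dI x : 0 < x -> is_derive x 1 I (phi x * f x).
Proof.
move=> x0; have [|//|dI1 I'] := @derive_int_below _ (fun t => phi t * f t) x _ x0.
- exact: real_L2M.
- by apply: cvgM; [exact: phi_cont|exact: f_cont].
- by rewrite -I'; exact: derivable_is_derive.
Qed.

Let dJ x : 0 < x -> is_derive x 1 J (- (theta x * f x)).
Proof.
move=> x0; have int := real_L2M theta_L2 f_L2.
apply: (@is_derive_open _ D (fun x => \int[mu]_(t in D) (theta t * f t) -
  int_below (fun t => theta t * f t) x) _ _ _ (@open_halfline R) x0).
- by move=> y y0; rewrite -int_aboveE.
rewrite -[X in is_derive _ _ _ X]sub0r; apply: is_derive_sub.
have [|dI1 I'] := @derive_int_below _ (fun t => theta t * f t) x int x0.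
  by apply: cvgM; [exact: theta_cont|exact: f_cont].
by rewrite -I'; exact: derivable_is_derive.
Qed.

(** The derivatives of [I] and [J] contribute theta phi f - phi theta f = 0, so f is absent and a
    second differentiation does not touch it. *)
Let dG x : 0 < x ->
  is_derive x 1 (green phi theta f) (derive1 theta x * I x + derive1 phi x * J x).
Proof.
move=> x0; have [dt _] := theta_reg x0; have [dp _] := phi_reg x0.
apply: (is_derive_eq (is_derive_add
  (is_derive_mul (derivable_is_derive dt) (dI x0))
  (is_derive_mul (derivable_is_derive dp) (dJ x0)))).
move: (derive1 theta x) (derive1 phi x) (I x) (J x) => *.
by ring.
Qed.

(** Here the derivatives of [I] and [J] contribute -W(phi, theta) f, which is -f by the
    normalisation of the Wronskian. *)
Let dpG x : 0 < x ->
  is_derive x 1 (qd (green phi theta f)) (q x * green phi theta f x - f x).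
Proof.
move=> x0; have [_ dt] := theta_reg x0; have [_ dp] := phi_reg x0.
apply: (@is_derive_open _ D (fun x => qd theta x * I x + qd phi x * J x)
  _ _ _ (@open_halfline R) x0).
- move=> y y0; rewrite [in RHS]/quasi_derivative (is_derive_derive1 (dG y0)).
  rewrite /quasi_derivative; move: (derive1 theta y) (derive1 phi y) (I y) (J y) => *.
  by ring.
apply: (is_derive_eq (is_derive_add
  (is_derive_mul (derivable_is_derive dt) (dI x0))
  (is_derive_mul (derivable_is_derive dp) (dJ x0)))).
rewrite (derive1_qd (theta_eq x0)) (derive1_qd (phi_eq x0)).
rewrite /green -/(I x) -/(J x) -[f x in RHS]mulr1 -(wronskian1 x0) /wronskian.
move: (qd theta x) (qd phi x) (I x) (J x) => *.
by ring.
Qed.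

Lemma green_regular : SLregular (green phi theta f).
Proof. by move=> x x0; split; [case: (dG x0)|case: (dpG x0)]. Qed.

Lemma SLreal_green x : 0 < x -> SLreal (green phi theta f) x = f x.
Proof. by move=> x0; rewrite /SLreal (is_derive_derive1 (dpG x0)) opprB subrK. Qed.

End GreenRegular.

Lemma green_near0 f (a x : R) : real_L2 f -> (forall y, 0 < y -> y < a -> f y = 0) ->
  0 < x -> x < a -> green phi theta f x = rdot theta f * phi x.
Proof.
move=> Lf fa x0 xa; have I0 v : int_below (fun t => v t * f t) x = 0.
  rewrite /int_below (@eq_Rintegral _ _ _ _ _ (fun=> 0)).
    by rewrite /Rintegral integral0.
  by move=> y; rewrite inE/= in_itv/= => /andP[y0 yx]; rewrite fa ?mulr0// (le_lt_trans yx).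
rewrite /green I0 mulr0 add0r int_aboveE//; last exact: real_L2M.
by rewrite I0 subr0 mulrC.
Qed.

Lemma green_near_infty f (b x : R) : real_L2 f -> (forall y, 0 < y -> b < y -> f y = 0) ->
  0 < x -> b <= x -> green phi theta f x = rdot phi f * theta x.
Proof.
move=> Lf fb x0 bx; have J0 v : int_above (fun t => v t * f t) x = 0.
  rewrite /int_above (@eq_Rintegral _ _ _ _ _ (fun=> 0)).
    by rewrite /Rintegral integral0.
  by move=> y; rewrite inE/= in_itv/= andbT => xy;
    rewrite fb ?mulr0 ?(le_lt_trans bx)// (lt_trans x0).
rewrite /green J0 mulr0 addr0 mulrC; congr (_ * _).
by rewrite /rdot -(int_belowDabove (real_L2M phi_L2 Lf) x0) J0 addr0.
Qed.

End SturmLiouvilleReal.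

(** * Regularity of solutions and uniqueness for vanishing initial data *)

Section Regularity.
Context {R : realType}.
Implicit Types (u v p q : R -> R) (x y z : R).
Notation D := (@halfline R).

Lemma Ck0P u : Ck 0 u <-> forall x, 0 < x -> {for x, continuous u}.
Proof. by split => [[_]|cu] //; split. Qed.

Lemma Ck1P u : Ck 1 u <-> forall x, 0 < x ->
  derivable u x 1 /\ {for x, continuous (derive1 u)}.
Proof.
split=> [[du cu] x x0|h]; first by split; [exact: (du 0%N)|exact: cu].
split=> [[|j] x j1 x0|x x0]; last by have [_ c] := h x x0; exact: c.
- by have [d _] := h x x0; exact: d.
- by rewrite !ltnS ltn0 in j1.
Qed.

Lemma Ck2P u : Ck 2 u <-> forall x, 0 < x ->
  [/\ derivable u x 1, derivable (derive1 u) x 1 &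
      {for x, continuous (derive1 (derive1 u))}].
Proof.
split=> [[du cu] x x0|h].
  by split; [exact: (du 0%N)|exact: (du 1%N)|exact: cu].
split=> [[|[|j]] x j2 x0|x x0]; last by have [_ _ c] := h x x0; exact: c.
- by have [d _ _] := h x x0; exact: d.
- by have [_ d _] := h x x0; exact: d.
- by rewrite !ltnS ltn0 in j2.
Qed.

Lemma Csmooth_C2 u : Csmooth u -> Ck 2 u.
Proof. exact. Qed.

Lemma C2_mul u v : Ck 2 u -> Ck 2 v -> Ck 2 (fun x => u x * v x).
Proof.
move=> /Ck2P cu /Ck2P cv; apply/Ck2P.
have d1 x : 0 < x -> is_derive x 1 (fun x => u x * v x)
    (derive1 u x * v x + u x * derive1 v x).
  move=> x0; have [du _ _] := cu _ x0; have [dv _ _] := cv _ x0.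
  exact: is_derive_mul (derivable_is_derive du) (derivable_is_derive dv).
pose w x := (derive1 (derive1 u) x * v x + derive1 u x * derive1 v x) +
  (derive1 u x * derive1 v x + u x * derive1 (derive1 v) x).
have d2 x : 0 < x -> is_derive x 1 (derive1 (fun x => u x * v x)) (w x).
  move=> x0; have [du ddu _] := cu _ x0; have [dv ddv _] := cv _ x0.
  apply: (@is_derive_open _ D (fun x => derive1 u x * v x + u x * derive1 v x)
    _ _ _ (@open_halfline R) x0).
    by move=> y y0; rewrite (is_derive_derive1 (d1 _ y0)).
  exact: is_derive_add
    (is_derive_mul (derivable_is_derive ddu) (derivable_is_derive dv))
    (is_derive_mul (derivable_is_derive du) (derivable_is_derive ddv)).
move=> x x0; split; [by case: (d1 x x0)|by case: (d2 x x0)|].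
apply: (@continuous_open _ D w _ _ (@open_halfline R) x0).
  by move=> y y0; rewrite (is_derive_derive1 (d2 _ y0)).
have [du ddu cddu] := cu _ x0; have [dv ddv cddv] := cv _ x0.
have ct (f : R -> R) : derivable f x 1 -> {for x, continuous f}.
  by move=> /derivable_is_derive/is_derive_continuous.
apply: cvgD; apply: cvgD; apply: cvgM.
- exact: cddu.
- exact: ct dv.
- exact: ct ddu.
- exact: ct ddv.
- exact: ct ddu.
- exact: ct ddv.
- exact: ct du.
- exact: cddv.
Qed.

Lemma SLregular_C2 p u : Ck 1 p -> Ck 2 u -> SLregular p u.
Proof.
move=> /Ck1P cp /Ck2P cu x x0; have [dp _] := cp _ x0; have [du ddu _] := cu _ x0.
split; first exact: du.
by have [] := is_derive_mul (derivable_is_derive dp) (derivable_is_derive ddu).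
Qed.

Lemma SLreal_continuous p q u : Ck 1 p -> Ck 0 q -> Ck 2 u ->
  forall x, 0 < x -> {for x, continuous (SLreal p q u)}.
Proof.
move=> /Ck1P cp /Ck0P cq /Ck2P cu x x0.
pose w x := - (derive1 p x * derive1 u x + p x * derive1 (derive1 u) x) + q x * u x.
apply: (@continuous_open _ D w _ _ (@open_halfline R) x0).
  move=> y y0; have [dp _] := cp _ y0; have [du ddu _] := cu _ y0.
  rewrite /w /SLreal.
  by rewrite (is_derive_derive1 (is_derive_mul (derivable_is_derive dp) (derivable_is_derive ddu))).
have [dp cdp] := cp _ x0; have [du ddu cddu] := cu _ x0.
have ct (f : R -> R) : derivable f x 1 -> {for x, continuous f}.
  by move=> /derivable_is_derive/is_derive_continuous.
apply: cvgD; last by apply: cvgM; [exact: cq|exact: ct du].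
apply: cvgN; apply: cvgD; apply: cvgM.
- exact: cdp.
- exact: ct ddu.
- exact: ct dp.
- exact: cddu.
Qed.

(** The equation gives a continuous derivative of pu', and dividing by the positive C^1 function p
    transfers this to u'. It places theta and the functions G f in the class C^2 demanded by the
    domain of A_00. *)
Lemma C2_SLregular p q u : Ck 1 p -> Ck 0 q -> (forall x, 0 < x -> 0 < p x) ->
  SLregular p u -> (forall x, 0 < x -> {for x, continuous (SLreal p q u)}) ->
  Ck 2 u.
Proof.
move=> /Ck1P cp /Ck0P cq p_gt0 ru cLu; apply/Ck2P.
pose qd := quasi_derivative p u.
have dqd x : 0 < x -> is_derive x 1 qd (q x * u x - SLreal p q u x).
  move=> x0; have [_ dpu] := ru _ x0.
  apply: (is_derive_eq (derivable_is_derive dpu)).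
  by rewrite /SLreal opprD opprK addrCA subrr addr0.
pose w x := (q x * u x - SLreal p q u x) * (p x)^-1 +
   qd x * (- derive1 p x / p x ^+ 2).
have d2 x : 0 < x -> is_derive x 1 (derive1 u) (w x).
  move=> x0; have [dp _] := cp _ x0.
  apply: (@is_derive_open _ D (fun x => qd x * (p x)^-1) _ _ _ (@open_halfline R) x0).
    by move=> y y0; rewrite /qd /quasi_derivative mulrAC divff ?mul1r// gt_eqF// p_gt0.
  apply: is_derive_mul (dqd _ x0) (is_derive_inv (derivable_is_derive dp) _).
  by rewrite gt_eqF ?p_gt0.
move=> x x0; have [du _] := ru _ x0; split; [exact: du|by case: (d2 x x0)|].
apply: (@continuous_open _ D w _ _ (@open_halfline R) x0).
  by move=> y y0; rewrite (is_derive_derive1 (d2 _ y0)).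
have [dp cdp] := cp _ x0.
have pn0 : p x != 0 by rewrite gt_eqF// p_gt0.
have cpx : {for x, continuous p} := is_derive_continuous (derivable_is_derive dp).
apply: cvgD; apply: cvgM.
- apply: cvgB; last exact: cLu.
  apply: cvgM; first exact: cq.
  exact: is_derive_continuous (derivable_is_derive du).
- exact: cvgV pn0 cpx.
- exact: is_derive_continuous (dqd _ x0).
- apply: cvgM; first exact: cvgN cdp.
  apply: cvgV; first by rewrite expf_neq0.
  by rewrite expr2; apply: (cvgM cpx cpx).
Qed.

End Regularity.

(** * Limits and constancy of Wronskians *)

Section Wronskian.
Context {R : realType}.
Implicit Types (u v : R -> R) (x y z : R).
Variables (p q : R -> R) (p0 : R).
Hypothesis p_lim : p x @[x --> 0^'+] --> p0.

Lemma wronskian_cvg u v (a a' b b' : R) :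
  u x @[x --> 0^'+] --> a -> derive1 u x @[x --> 0^'+] --> a' ->
  v x @[x --> 0^'+] --> b -> derive1 v x @[x --> 0^'+] --> b' ->
  wronskian p u v x @[x --> 0^'+] --> p0 * a' * b - a * (p0 * b').
Proof.
by move=> ua ua' vb vb'; apply: cvgB; apply: cvgM => //; apply: cvgM.
Qed.

(** By Lagrange's identity the derivative is zero, and the constant is identified by the limit at
    0. *)
Lemma wronskian_cst u v (c : R) : SLregular p u -> SLregular p v ->
  (forall x, 0 < x -> SLreal p q u x = 0) -> (forall x, 0 < x -> SLreal p q v x = 0) ->
  wronskian p u v x @[x --> 0^'+] --> c -> forall x, 0 < x -> wronskian p u v x = c.
Proof.
move=> ru rv eu ev Wc x x0.
have dW z : 0 < z -> is_derive z 1 (wronskian p u v) 0.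
  move=> z0; apply: (is_derive_eq (is_derive_wronskian q ru rv z0)).
  by rewrite eu// ev// mul0r mulr0 subrr.
have Wcst y : 0 < y -> wronskian p u v y = wronskian p u v x.
  move=> y0; apply: zero_derive_halfline => // z z0; first by case: (dW z z0).
  exact: is_derive_derive1 (dW z z0).
apply: (@cvg_unique _ (@Rhausdorff R) _ _ _ _ _ Wc).
by apply: cvg_near_cst; near=> y; rewrite Wcst.
Unshelve. all: by end_near. Qed.

(* The Wronskians of [v] with both fundamental solutions vanish, and these
   solutions span the Cauchy data at every point. *)
Lemma SLsolution_zero u v w : SLregular p u -> SLregular p v -> SLregular p w ->
  (forall x, 0 < x -> SLreal p q u x = 0) -> (forall x, 0 < x -> SLreal p q v x = 0) ->
  (forall x, 0 < x -> SLreal p q w x = 0) ->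
  (forall x, 0 < x -> wronskian p u v x = 1) ->
  wronskian p w u x @[x --> 0^'+] --> 0 -> wronskian p w v x @[x --> 0^'+] --> 0 ->
  forall x, 0 < x -> w x = 0.
Proof.
move=> ru rv rw eu ev ew W1 wu wv x x0.
have := wronskian_cst rw ru ew eu wu x0; have := wronskian_cst rw rv ew ev wv x0.
rewrite /wronskian => /eqP; rewrite subr_eq0 => /eqP h1 /eqP.
rewrite subr_eq0 => /eqP h2.
rewrite -[w x]mulr1 -(W1 _ x0) /wronskian mulrBr.
rewrite [X in X - _]mulrA -h2 [X in _ - X]mulrCA -h1.
by move: (quasi_derivative p w x) => *; ring.
Qed.

End Wronskian.

(** * Real and imaginary parts of the complex expression *)

Section ComplexParts.
Context {R : realType}.
Implicit Types (u v : R -> R[i]) (x y z : R) (p q : R -> R).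

Definition rpart u : R -> R := fun x => complex.Re (u x).
Definition ipart u : R -> R := fun x => complex.Im (u x).

Lemma complex_parts u x : u x = rpart u x +i* ipart u x.
Proof. by rewrite /rpart /ipart; case: (u x). Qed.

Lemma ReM_real (a : R) (c : R[i]) : complex.Re (a%:C * c) = a * complex.Re c.
Proof. by case: c => c d /=; rewrite mul0r subr0. Qed.

Lemma ImM_real (a : R) (c : R[i]) : complex.Im (a%:C * c) = a * complex.Im c.
Proof. by case: c => c d /=; rewrite mul0r addr0. Qed.

Lemma rpart_p_cderiv p u :
  (fun y => complex.Re ((p y)%:C * cderiv u y)) = quasi_derivative p (rpart u).
Proof. by apply/funext => y; rewrite ReM_real. Qed.

Lemma ipart_p_cderiv p u :
  (fun y => complex.Im ((p y)%:C * cderiv u y)) = quasi_derivative p (ipart u).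
Proof. by apply/funext => y; rewrite ImM_real. Qed.

Lemma SLexprE p q u x :
  SLexpr p q u x = SLreal p q (rpart u) x +i* SLreal p q (ipart u) x.
Proof.
rewrite /SLexpr /cderiv rpart_p_cderiv ipart_p_cderiv [u x]complex_parts /SLreal.
move: (derive1 (quasi_derivative p (rpart u)) x) (derive1 (quasi_derivative p (ipart u)) x).
by move=> a b; simpc.
Qed.

(** The coefficients and the spectral parameter 0 are real, so the equation decouples. *)
Lemma SLsolution_parts p q u : SLsolution p q 0 u ->
  [/\ SLregular p (rpart u), SLregular p (ipart u),
      (forall x, 0 < x -> SLreal p q (rpart u) x = 0) &
      (forall x, 0 < x -> SLreal p q (ipart u) x = 0)].
Proof.
move=> su; split => x x0; have [[d1 d2] [d3 d4]] := su x x0.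
- by split; [exact: d1|move: d3; rewrite rpart_p_cderiv; exact].
- by split; [exact: d2|move: d4; rewrite ipart_p_cderiv; exact].
- by rewrite SLexprE mul0r => -[].
- by rewrite SLexprE mul0r => -[].
Qed.

End ComplexParts.

(** * Complex square-integrable functions *)

Section ComplexL2.
Context {R : realType}.
Implicit Types (u v w f g : R -> R[i]) (c : R[i]).
Notation mu := (@lebesgue_measure R).
Notation D := (@halfline R).
Let mD : measurable D := measurable_halfline.
Hint Resolve mD : core.

Lemma in_L2P u : in_L2 u <-> real_L2 (rpart u) /\ real_L2 (ipart u).
Proof.
split=> [[mr mi ioo]|[[mr ir] [mi ii]]]; last first.
  split => //; have /integrableP[_] : mu.-integrable D
    ((EFin \o (fun x => rpart u x ^+ 2)%R) \+ (EFin \o (fun x => ipart u x ^+ 2)%R))%E.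
    exact: integrableD.
  apply: le_lt_trans; rewrite le_eqVlt; apply/orP; left; apply/eqP.
  apply: eq_integral => x _ /=; rewrite ger0_norm//.
  by rewrite addr_ge0// sqr_ge0.
have int : mu.-integrable D (EFin \o (fun x => sqnorm (u x))).
  apply/integrableP; split.
    apply/measurable_EFinP; apply: measurable_funD; exact: measurable_funX.
  apply: le_lt_trans ioo; rewrite le_eqVlt; apply/orP; left; apply/eqP.
  apply: eq_integral => x _ /=; rewrite ger0_norm//.
  by rewrite addr_ge0// sqr_ge0.
split; split => //; apply: le_integrable int => //.
- by apply/measurable_EFinP; exact: measurable_funX.
- move=> x _ /=; rewrite lee_fin !ger0_norm ?addr_ge0 ?sqr_ge0//.
  by rewrite lerDl sqr_ge0.
- by apply/measurable_EFinP; exact: measurable_funX.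
- move=> x _ /=; rewrite lee_fin !ger0_norm ?addr_ge0 ?sqr_ge0//.
  by rewrite lerDr sqr_ge0.
Qed.

Lemma L2eqP u v : L2eq u v <->
  ae_eq mu D (rpart u) (rpart v) /\ ae_eq mu D (ipart u) (ipart v).
Proof.
split=> [uv|[]]; last first.
  apply: filterS2 => x hr hi Dx; have := hr Dx; have := hi Dx.
  by rewrite [u x]complex_parts [v x]complex_parts => -> ->.
by split; move: uv; apply: filterS => x h Dx; rewrite /rpart /ipart h.
Qed.

Lemma L2eq_refl u : L2eq u u. Proof. exact: ae_eq_refl. Qed.

Lemma L2eq_sym u v : L2eq u v -> L2eq v u. Proof. exact: ae_eq_sym. Qed.

Lemma L2eq_trans u v w : L2eq u v -> L2eq v w -> L2eq u w.
Proof. exact: ae_eq_trans. Qed.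

Lemma L2eq_halfline u v : (forall x, 0 < x -> u x = v x) -> L2eq u v.
Proof. by move=> uv; apply: aeW => x; exact: uv. Qed.

Lemma rpart_lin c u v : rpart (fun x => c * u x + v x) =
  fun x => complex.Re c * rpart u x + (- complex.Im c * ipart u x + rpart v x).
Proof.
apply/funext => x; rewrite /rpart /ipart.
by case: c (u x) (v x) => a b [d e] [k l] /=; rewrite mulNr addrA.
Qed.

Lemma ipart_lin c u v : ipart (fun x => c * u x + v x) =
  fun x => complex.Re c * ipart u x + (complex.Im c * rpart u x + ipart v x).
Proof.
apply/funext => x; rewrite /rpart /ipart.
by case: c (u x) (v x) => a b [d e] [k l] /=; rewrite addrA.
Qed.

Lemma in_L2_lin c u v : in_L2 u -> in_L2 v -> in_L2 (fun x => c * u x + v x).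
Proof.
move=> /in_L2P[ur ui] /in_L2P[vr vi]; apply/in_L2P.
by rewrite rpart_lin ipart_lin; split; apply: real_L2_lin => //; exact: real_L2_lin.
Qed.

Lemma in_L2_0 : in_L2 (fun=> 0 : R[i]).
Proof. by apply/in_L2P; split; exact: real_L2_0. Qed.

Lemma L2dotE u v : in_L2 u -> in_L2 v ->
  L2dot u v = (rdot (rpart u) (rpart v) + rdot (ipart u) (ipart v)) +i*
              (rdot (ipart u) (rpart v) - rdot (rpart u) (ipart v)).
Proof.
move=> /in_L2P[ur ui] /in_L2P[vr vi]; rewrite /L2dot /cintegral /rdot.
rewrite -RintegralD//; [|exact: real_L2M..].
rewrite -RintegralB//; [|exact: real_L2M..].
congr (_ +i* _); apply: eq_Rintegral => x _; rewrite /rpart /ipart;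
  by case: (u x) (v x) => a b [d e] /=; rewrite mulrN ?opprK// addrC.
Qed.

Lemma conjc_def (z : R[i]) : z^* = complex.Re z +i* - complex.Im z.
Proof. by case: z. Qed.

Lemma L2dot_conj u v : in_L2 u -> in_L2 v -> L2dot v u = (L2dot u v)^*.
Proof.
move=> Lu Lv; rewrite !L2dotE// conjc_def /= opprB.
by rewrite (rdotC (rpart v)) (rdotC (ipart v) (ipart u)) (rdotC (ipart v)) (rdotC (rpart v)).
Qed.

Lemma L2dot_linl c u v w : in_L2 u -> in_L2 v -> in_L2 w ->
  L2dot (fun x => c * u x + v x) w = c * L2dot u w + L2dot v w.
Proof.
move=> Lu Lv Lw; rewrite !L2dotE//; last exact: in_L2_lin.
move: Lu Lv Lw => /in_L2P[ur ui] /in_L2P[vr vi] /in_L2P[wr wi].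
rewrite rpart_lin ipart_lin !rdot_linl//; [|exact: real_L2_lin..].
by case: c => a b /=; simpc; congr (_ +i* _); ring.
Qed.

Lemma L2dot_linr c u v w : in_L2 u -> in_L2 v -> in_L2 w ->
  L2dot w (fun x => c * u x + v x) = conjc c * L2dot w u + L2dot w v.
Proof.
move=> Lu Lv Lw; rewrite L2dot_conj//; last exact: in_L2_lin.
rewrite L2dot_linl// [L2dot w u]L2dot_conj// [L2dot w v]L2dot_conj//.
by rewrite rmorphD rmorphM.
Qed.

Lemma in_L2_ae u v : in_L2 u -> measurable_fun D (rpart v) ->
  measurable_fun D (ipart v) -> L2eq u v -> in_L2 v.
Proof.
move=> /in_L2P[ur ui] mr mi /L2eqP[hr hi]; apply/in_L2P.
by split; [exact: real_L2_ae hr|exact: real_L2_ae hi].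
Qed.

Lemma L2dot_ae u u' v v' : in_L2 u -> in_L2 u' -> in_L2 v -> in_L2 v' ->
  L2eq u u' -> L2eq v v' -> L2dot u v = L2dot u' v'.
Proof.
move=> Lu Lu' Lv Lv' /L2eqP[ur ui] /L2eqP[vr vi]; rewrite !L2dotE//.
move: Lu Lu' Lv Lv' => /in_L2P[L1 L2] /in_L2P[L3 L4] /in_L2P[L5 L6] /in_L2P[L7 L8].
have m1 := L3.1; have m2 := L4.1; have m3 := L7.1; have m4 := L8.1.
by congr ((_ + _) +i* (_ - _)); exact: rdot_ae.
Qed.

Lemma L2dot_eq0 u : in_L2 u -> L2dot u u = 0 -> L2eq u (fun=> 0).
Proof.
move=> Lu; rewrite L2dotE// => -[/eqP].
rewrite paddr_eq0 ?rdot_ge0// => /andP[/eqP hr /eqP hi] _.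
by move/in_L2P: Lu => [Lr Li]; apply/L2eqP; split; exact: rdot_eq0.
Qed.

Lemma L2distE u v : in_L2 u -> in_L2 v -> L2dist u v =
  Num.sqrt (rnorm (fun x => rpart u x - rpart v x) ^+ 2 +
            rnorm (fun x => ipart u x - ipart v x) ^+ 2).
Proof.
move=> /in_L2P[ur ui] /in_L2P[vr vi]; rewrite /L2dist !rnorm2 /rdot.
rewrite -RintegralD//; [|by apply: real_L2M; exact: real_L2B..].
congr Num.sqrt; apply: eq_Rintegral => x _; rewrite /rpart /ipart /sqnorm.
by case: (u x) (v x) => a b [d e] /=; rewrite !expr2.
Qed.

Lemma L2dist_ger u v : in_L2 u -> in_L2 v ->
  rnorm (fun x => rpart u x - rpart v x) <= L2dist u v.
Proof.
move=> Lu Lv; rewrite L2distE// -[leLHS]ger0_norm ?rnorm_ge0// -sqrtr_sqr.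
by rewrite ler_wsqrtr// lerDl sqr_ge0.
Qed.

Lemma L2dist_gei u v : in_L2 u -> in_L2 v ->
  rnorm (fun x => ipart u x - ipart v x) <= L2dist u v.
Proof.
move=> Lu Lv; rewrite L2distE// -[leLHS]ger0_norm ?rnorm_ge0// -sqrtr_sqr.
by rewrite ler_wsqrtr// lerDr sqr_ge0.
Qed.

Lemma L2dist_le u v : in_L2 u -> in_L2 v -> L2dist u v <=
  rnorm (fun x => rpart u x - rpart v x) + rnorm (fun x => ipart u x - ipart v x).
Proof.
move=> Lu Lv; rewrite L2distE//.
set a := rnorm _; set b := rnorm _.
have a0 : 0 <= a by exact: rnorm_ge0.
have b0 : 0 <= b by exact: rnorm_ge0.
rewrite -[leRHS]ger0_norm ?addr_ge0// -sqrtr_sqr ler_wsqrtr//.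
by rewrite sqrrD -addrA lerD2l lerDr mulrn_wge0// mulr_ge0.
Qed.

End ComplexL2.

(** * Real test functions and the boundary condition *)

Section RealDomain.
Context {R : realType}.
Implicit Types (u v f g : R -> R) (x y z : R).
Notation mu := (@lebesgue_measure R).
Notation D := (@halfline R).
Let mD : measurable D := measurable_halfline.
Hint Resolve mD : core.
Variables (p q : R -> R) (p0 : R) (alpha : option R) (phi theta : R -> R) (t0 t1 : R).
Hypotheses (p_C1 : Ck 1 p) (q_C0 : Ck 0 q)
  (p_lim : p x @[x --> 0^'+] --> p0) (p_gt0 : forall x, 0 < x -> 0 < p x)
  (phi_L2 : real_L2 phi) (theta_L2 : real_L2 theta)
  (phi_reg : SLregular p phi) (theta_reg : SLregular p theta)
  (phi_eq : forall x, 0 < x -> SLreal p q phi x = 0)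
  (theta_eq : forall x, 0 < x -> SLreal p q theta x = 0)
  (wronskian1 : forall x, 0 < x -> wronskian p phi theta x = 1)
  (phi_lim : phi x @[x --> 0^'+] --> ((if alpha is Some _ then 1 else 0) : R))
  (dphi_lim : derive1 phi x @[x --> 0^'+] --> ((if alpha is Some al then al else 1) : R))
  (theta_lim : theta x @[x --> 0^'+] --> t0)
  (dtheta_lim : derive1 theta x @[x --> 0^'+] --> t1).

(** The right-hand sides for which G f is explicit near both ends. In contrast to
    [bounded_supported], nothing is asked for x <= 0, where the values of the given data are
    arbitrary. *)
Definition test_function f : Prop :=
  [/\ real_L2 f, (forall x, 0 < x -> {for x, continuous f}) &
      exists a b, 0 < a /\ forall x, 0 < x -> x < a \/ b < x -> f x = 0].

Definition boundary_relation (a b : R) : Prop :=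
  if alpha is Some al then b = al * a else a = 0.

Lemma SLreal0 x : SLreal p q (fun=> 0) x = 0.
Proof.
have qd0 : quasi_derivative p (fun=> 0) = cst 0.
  by apply/funext => y; rewrite /quasi_derivative derive1_cst mulr0.
by rewrite /SLreal qd0 derive1_cst mulr0 oppr0 addr0.
Qed.

Lemma wronskian0 v x : wronskian p v (fun=> 0) x = 0.
Proof. by rewrite /wronskian mulr0 /quasi_derivative derive1_cst !mulr0 subrr. Qed.

Lemma wronskian_open (A : set R) v u w x : open A -> A x ->
  (forall y, A y -> u y = w y) -> wronskian p v u x = wronskian p v w x.
Proof.
by move=> oA Ax uw; rewrite /wronskian /quasi_derivative (derive1_open oA Ax uw) (uw _ Ax).
Qed.

(** As phi and u satisfy the same real boundary condition, W(phi, u) tends to 0 at 0; near infinity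
    all Wronskians with u vanish. *)
Lemma real_domain u (a b : R) : Ck 2 u -> (\forall x \near +oo, u x = 0) ->
  u x @[x --> 0^'+] --> a -> derive1 u x @[x --> 0^'+] --> b ->
  boundary_relation a b -> real_L2 (SLreal p q u) ->
  (forall x, 0 < x -> green phi theta (SLreal p q u) x = u x) /\
  rdot phi (SLreal p q u) = 0.
Proof.
move=> cu [M [_ uM]] ua ub ab Lu.
have ru := SLregular_C2 p_C1 cu; have cLu := SLreal_continuous p_C1 q_C0 cu.
have Wphi : wronskian p phi u x @[x --> 0^'+] --> 0.
  have := wronskian_cvg p_lim phi_lim dphi_lim ua ub.
  by move: ab; rewrite /boundary_relation; case: alpha => [al ->|->];
    rewrite (_ : _ - _ = 0)//; ring.
have Wtheta := wronskian_cvg p_lim theta_lim dtheta_lim ua ub.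
have uoo v : \forall x \near +oo, SLreal p q u x = 0 /\ wronskian p v u x = 0.
  exists M; split; first exact: num_real.
  move=> x Mx; have oM : open `]M, +oo[%classic by exact: interval_open.
  have xM : `]M, +oo[%classic x by rewrite /= in_itv/= Mx.
  have u0 y : `]M, +oo[%classic y -> u y = (fun=> 0) y.
    by rewrite /= in_itv/= andbT => /uM.
  by rewrite (SLreal_open p q oM xM u0) SLreal0 (wronskian_open v oM xM u0) wronskian0.
split; last exact: (rdot_phi_SLreal phi_L2 phi_reg phi_eq ru cLu Lu Wphi (uoo phi)).
exact: (green_SLreal phi_L2 theta_L2 phi_reg theta_reg phi_eq theta_eq wronskian1
  ru cLu Lu Wphi Wtheta (uoo theta)).
Qed.

(** Orthogonality to phi removes the multiple of theta beyond the support of f. Below the support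
    only a multiple of phi remains, and it carries the boundary condition. *)
Lemma test_function_green f : test_function f -> rdot phi f = 0 ->
  [/\ Ck 2 (green phi theta f),
      (\forall x \near +oo, green phi theta f x = 0),
      (exists a b, [/\ green phi theta f x @[x --> 0^'+] --> a,
         derive1 (green phi theta f) x @[x --> 0^'+] --> b & boundary_relation a b]) &
      forall x, 0 < x -> SLreal p q (green phi theta f) x = f x].
Proof.
move=> [Lf cf [a [b [a0 fab]]]] phif.
have SLf := SLreal_green phi_L2 theta_L2 phi_reg theta_reg phi_eq theta_eq wronskian1 cf Lf.
have oD := @open_halfline R.
split; last exact: SLf.
- apply: (C2_SLregular p_C1 q_C0 p_gt0).
    exact: (green_regular phi_L2 theta_L2 phi_reg theta_reg phi_eq theta_eq wronskian1 cf Lf).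
  move=> x x0; apply: (continuous_open oD x0 _ (cf x x0)) => y y0.
  by rewrite SLf.
(* The maximum with 1 keeps x in the half-line. *)
- exists (Num.max b 1); split; first exact: num_real.
  move=> x; rewrite gt_max => /andP[bx x1].
  rewrite (green_near_infty theta phi_L2 Lf _ (lt_trans ltr01 x1) (ltW bx)).
    by rewrite phif mul0r.
  by move=> y y0 ay; apply: fab => //; right.
- pose C := rdot theta f.
  have nr0 x : 0 < x -> x < a -> green phi theta f x = C * phi x.
    by move=> x0 xa; apply: (green_near0 phi theta_L2 Lf _ x0 xa) => y y0 ya;
      apply: fab => //; left.
  have oa : open `]0, a[%classic by exact: interval_open.
  have near_a : \forall x \near 0^'+, 0 < x /\ x < a.
    near=> x; split => //; near: x; exact: nbhs_right_lt.
  exists (C * (if alpha is Some _ then 1 else 0)),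
    (C * (if alpha is Some al then al else 1)); split.
  + apply: cvg_trans (cvgM (cvg_cst C) phi_lim); apply: near_eq_cvg.
    by apply: filterS near_a => x [x0 xa]; rewrite nr0.
  + apply: cvg_trans (cvgM (cvg_cst C) dphi_lim); apply: near_eq_cvg.
    apply: filterS near_a => x [x0 xa].
    have Ax : `]0, a[%classic x by rewrite /= in_itv/= x0.
    have e y : `]0, a[%classic y -> green phi theta f y = C * phi y.
      by rewrite /= in_itv/= => /andP[y0 ya]; rewrite nr0.
    rewrite (derive1_open oa Ax e) derive1Ml//.
    exact: (phi_reg x0).1.
  + by rewrite /boundary_relation; case: alpha => [al|]; ring.
Unshelve. all: by end_near. Qed.

Lemma test_function_lin (c : R) f g : test_function f -> test_function g ->
  test_function (fun x => c * f x + g x).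
Proof.
move=> [Lf cf [a [b [a0 fab]]]] [Lg cg [a' [b' [a'0 gab]]]]; split.
- exact: real_L2_lin.
- move=> x x0; apply: cvgD; last exact: cg.
  by apply: cvgM; [exact: cvg_cst|exact: cf].
- exists (Num.min a a'), (Num.max b b'); split; first by rewrite lt_min a0.
  move=> x x0; rewrite lt_min gt_max => xab; rewrite fab ?gab ?mulr0 ?addr0//.
    by case: xab => /andP[? ?]; [left|right].
  by case: xab => /andP[? ?]; [left|right].
Qed.

Lemma bounded_supported_test f : bounded_supported f -> Ck 2 f -> test_function f.
Proof.
move=> bf cf; split; first exact: bounded_supported_L2.
  move=> x x0; move/Ck2P: cf => /(_ x x0)[df _ _].
  exact: is_derive_continuous (derivable_is_derive df).
by have [_ _ [a [b [a0 sf]]]] := bf; exists a, b; split => // x _; exact: sf.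
Qed.

(** Square-integrability comes from continuity on the compact segment [[a, b]] inside the
    half-line. *)
Lemma test_function_of_support f (a b : R) : 0 < a ->
  (forall x, 0 < x -> {for x, continuous f}) ->
  (forall x, 0 < x -> x < a \/ b < x -> f x = 0) -> test_function f.
Proof.
move=> a0 cf fab; split => //; last by exists a, b.
split; first exact: measurable_continuous_halfline.
have abD : `[a, b] `<=` D.
  by move=> x /=; rewrite in_itv/= => /andP[+ _]; exact: lt_le_trans.
have i1 : mu.-integrable `[a, b] (EFin \o (fun x => f x ^+ 2)).
  apply: continuous_compact_integrable; first exact: segment_compact.
  apply: continuous_in_subspaceT => x; rewrite inE => /abD x0.
  by rewrite /continuous_at expr2; under eq_cvg do rewrite expr2; apply: cvgM; exact: cf.
have : mu.-integrable D (EFin \o ((fun x => f x ^+ 2) \_ `[a, b])).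
  rewrite -restrict_EFin; apply: (@integrableS _ _ _ mu setT) => //.
  by rewrite -integrable_mkcond.
apply: eq_integrable => // x; rewrite inE => x0 /=; rewrite patchE.
case: ifPn => // /negP; rewrite inE/= in_itv/= => /negP; rewrite negb_and -!ltNge => /orP h.
by rewrite fab// expr0n.
Qed.

(** The product omega theta vanishes near 0 and solves the homogeneous equation far out, so its
    image is supported in between; its Wronskian with phi is 0 near 0 and W(phi, theta) = 1 far
    out. *)
Lemma cutoff_theta (omega : R -> R) : cutoff omega ->
  [/\ test_function (SLreal p q (fun x => omega x * theta x)),
      (forall x, 0 < x ->
        green phi theta (SLreal p q (fun x => omega x * theta x)) x = omega x * theta x) &
      rdot phi (SLreal p q (fun x => omega x * theta x)) = 1].
Proof.
move=> [/Csmooth_C2 comega om0 [M [_ omM]]].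
have ctheta : Ck 2 theta.
  apply: (C2_SLregular p_C1 q_C0 p_gt0 theta_reg) => x x0.
  apply: (continuous_open (@open_halfline R) x0 _ (cvg_cst 0)) => y y0.
  by rewrite theta_eq.
set u := fun x => omega x * theta x.
have cu : Ck 2 u by exact: C2_mul.
have ru := SLregular_C2 p_C1 cu; have cLu := SLreal_continuous p_C1 q_C0 cu.
have [a a0 oma] : exists2 a, 0 < a & forall x, 0 < x -> x < a -> omega x = 0.
  move: om0; rewrite near_withinE => /nbhs_ballP[a /= a0 oma]; exists a => // x x0 xa.
  by apply: oma => //=; rewrite /ball/= sub0r normrN gtr0_norm.
have oa : open `]0, a[%classic by exact: interval_open.
have u0 y : `]0, a[%classic y -> u y = (fun=> 0) y.
  by rewrite /= in_itv/= => /andP[y0 ya]; rewrite /u oma// mul0r.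
pose b := Num.max M 0.
have ob : open `]b, +oo[%classic by exact: interval_open.
have ub y : `]b, +oo[%classic y -> u y = theta y.
  by rewrite /= in_itv/= andbT gt_max => /andP[My _]; rewrite /u omM// mul1r.
have b0 y : b < y -> 0 < y by rewrite gt_max => /andP[].
have ty : test_function (SLreal p q u).
  apply: (@test_function_of_support _ a b) => // x x0 [xa|bx].
    have Ax : `]0, a[%classic x by rewrite /= in_itv/= x0.
    by rewrite (SLreal_open p q oa Ax u0) SLreal0.
  have Bx : `]b, +oo[%classic x by rewrite /= in_itv/= bx.
  by rewrite (SLreal_open p q ob Bx ub) theta_eq.
have [Lu _ _] := ty.
have W0 v : wronskian p v u x @[x --> 0^'+] --> 0.
  apply: cvg_near_cst; near=> x.
  have Ax : `]0, a[%classic x.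
    rewrite /= in_itv/=; apply/andP; split; near: x.
      exact: nbhs_right_gt.
    exact: nbhs_right_lt.
  by rewrite (wronskian_open v oa Ax u0) wronskian0.
have uoo v (c : R) : (forall x, 0 < x -> wronskian p v theta x = c) ->
    \forall x \near +oo, SLreal p q u x = 0 /\ wronskian p v u x = c.
  move=> vc; exists b; split; first exact: num_real.
  move=> x bx; have Bx : `]b, +oo[%classic x by rewrite /= in_itv/= bx.
  rewrite (SLreal_open p q ob Bx ub) (wronskian_open v ob Bx ub).
  by rewrite theta_eq ?vc ?b0.
(* Far out omega theta is theta, so its Wronskian with theta vanishes there although the function
   does not have bounded support. *)
have tt x : 0 < x -> wronskian p theta theta x = 0.
  by move=> x0; rewrite /wronskian mulrC subrr.
split => //.
  exact: (green_SLreal phi_L2 theta_L2 phi_reg theta_reg phi_eq theta_eq wronskian1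
    ru cLu Lu (W0 phi) (W0 theta) (uoo theta 0 tt)).
exact: (rdot_phi_SLreal phi_L2 phi_reg phi_eq ru cLu Lu (W0 phi) (uoo phi 1 wronskian1)).
Unshelve. all: by end_near. Qed.

Variable omega : R -> R.
Hypothesis omega_cutoff : cutoff omega.

(* A test function with [rdot phi g = 1] corrects the approximation back into
   the orthogonal complement of [phi]. *)
Lemma test_function_dense f (e : R) : real_L2 f -> rdot phi f = 0 -> 0 < e ->
  exists g, [/\ test_function g, rdot phi g = 0,
    rnorm (fun x => f x - g x) < e &
    rnorm (fun x => green phi theta f x - green phi theta g x) < e].
Proof.
move=> Lf phif e0; have [tg0 _ phig0] := cutoff_theta omega_cutoff.
set g0 := SLreal p q _ in tg0 phig0; have [Lg0 _ _] := tg0.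
pose C := 2 * (rnorm phi * rnorm theta).
have C0 : 0 <= C by rewrite !mulr_ge0 ?rnorm_ge0.
(* [C] bounds the norm of G. Since <phi, f> = 0, the coefficient <phi, g> is at most the norm of phi
   times the error of g, so the correction by [g0] enlarges that error by at most the factor [K]. *)
pose K := 1 + rnorm phi * rnorm g0.
have K1 : 1 <= K by rewrite lerDl mulr_ge0 ?rnorm_ge0.
pose d := e / (K * (1 + C)).
have K0 : 0 < K := lt_le_trans ltr01 K1.
have C1 : 0 < 1 + C by rewrite ltr_wpDr.
have KC : 0 < K * (1 + C) by exact: mulr_gt0.
have d0 : 0 < d by rewrite divr_gt0.
have [g [bg cg ng]] := real_L2_dense Lf d0.
have tg := bounded_supported_test bg cg; have [Lg _ _] := tg.
pose h x := - rdot phi g * g0 x + g x.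
have th : test_function h by exact: test_function_lin.
have [Lh _ _] := th.
have nh : rnorm (fun x => f x - h x) < e / (1 + C).
  have -> : (fun x => f x - h x) = (fun x => (f x - g x) + rdot phi g * g0 x).
    by apply/funext => x; rewrite /h; ring.
  apply: le_lt_trans (rnorm_triangle (real_L2B Lf Lg) (real_L2Z _ Lg0)) _.
  have phig : `|rdot phi g| <= rnorm phi * rnorm (fun x => f x - g x).
    have -> : rdot phi g = - rdot (fun x => f x - g x) phi.
      by rewrite rdotBl// (rdotC f) phif sub0r opprK rdotC.
    by rewrite normrN mulrC; apply: rdot_norm => //; exact: real_L2B.
  rewrite rnormZ//.
  apply: (@le_lt_trans _ _ (K * rnorm (fun x => f x - g x))).
    rewrite /K mulrDl mul1r lerD2l mulrAC.
    by rewrite ler_wpM2r ?rnorm_ge0.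
  have -> : e / (1 + C) = K * d.
    by rewrite /d; field; rewrite !gt_eqF.
  by rewrite ltr_pM2l.
exists h; split => //.
- rewrite rdotC rdot_linl// (rdotC g0) phig0 (rdotC g) mulr1 addNr; by [].
- apply: lt_le_trans nh _; rewrite ler_pdivrMr// ler_peMr ?(ltW e0)//.
  by rewrite lerDl.
- apply: le_lt_trans (rnorm_greenB phi_L2 theta_L2 Lf Lh) _.
  apply: (@le_lt_trans _ _ (C * (e / (1 + C)))); first by rewrite ler_wpM2l// ltW.
  by rewrite mulrA ltr_pdivrMr// mulrC ltr_pM2l// ltrDr.
Qed.

End RealDomain.

(** * The minimal operator *)

Section MinimalOperator.
Context {R : realType}.
Implicit Types (u v f g w : R -> R[i]) (x y z : R).
Notation mu := (@lebesgue_measure R).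
Notation D := (@halfline R).
Let mD : measurable D := measurable_halfline.
Hint Resolve mD : core.
Variables (p q : R -> R) (p0 : R) (alpha : option R) (phi theta : R -> R) (t0 t1 : R).
Hypotheses (p_C1 : Ck 1 p) (q_C0 : Ck 0 q)
  (p_lim : p x @[x --> 0^'+] --> p0) (p_gt0 : forall x, 0 < x -> 0 < p x)
  (phi_L2 : real_L2 phi) (theta_L2 : real_L2 theta)
  (phi_reg : SLregular p phi) (theta_reg : SLregular p theta)
  (phi_eq : forall x, 0 < x -> SLreal p q phi x = 0)
  (theta_eq : forall x, 0 < x -> SLreal p q theta x = 0)
  (wronskian1 : forall x, 0 < x -> wronskian p phi theta x = 1)
  (phi_lim : phi x @[x --> 0^'+] --> ((if alpha is Some _ then 1 else 0) : R))
  (dphi_lim : derive1 phi x @[x --> 0^'+] --> ((if alpha is Some al then al else 1) : R))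
  (theta_lim : theta x @[x --> 0^'+] --> t0)
  (dtheta_lim : derive1 theta x @[x --> 0^'+] --> t1).

Definition cgreen f : R -> R[i] := fun x =>
  green phi theta (rpart f) x +i* green phi theta (ipart f) x.

Definition cphi : R -> R[i] := fun x => (phi x)%:C.

Lemma cphi_L2 : in_L2 cphi.
Proof. by apply/in_L2P; split; [exact: phi_L2|exact: real_L2_0]. Qed.

Lemma cgreen_L2 f : in_L2 f -> in_L2 (cgreen f).
Proof. by move=> /in_L2P[fr fi]; apply/in_L2P; split; exact: green_L2. Qed.

Lemma cgreen_sym f g : in_L2 f -> in_L2 g -> L2dot (cgreen f) g = L2dot f (cgreen g).
Proof.
move=> Lf Lg; rewrite !L2dotE//; try exact: cgreen_L2.
move: Lf Lg => /in_L2P[fr fi] /in_L2P[gr gi].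
by congr ((_ + _) +i* (_ - _)); exact: green_sym.
Qed.

Lemma cgreen_lin (c : R[i]) f g x : in_L2 f -> in_L2 g -> 0 < x ->
  cgreen (fun t => c * f t + g t) x = c * cgreen f x + cgreen g x.
Proof.
move=> /in_L2P[fr fi] /in_L2P[gr gi] x0; rewrite /cgreen rpart_lin ipart_lin.
rewrite !green_lin//; [|exact: real_L2_lin..].
by case: c => a b /=; simpc; congr (_ +i* _); ring.
Qed.

Lemma cgreen_ae f g : in_L2 f -> in_L2 g -> L2eq f g -> L2eq (cgreen f) (cgreen g).
Proof.
move=> /in_L2P[fr fi] /in_L2P[gr gi] /L2eqP[hr hi]; apply: L2eq_halfline => x x0.
by rewrite /cgreen (green_ae phi_L2 theta_L2 fr gr hr x0) (green_ae phi_L2 theta_L2 fi gi hi x0).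
Qed.

Lemma L2dot_cphi f : in_L2 f ->
  L2dot f cphi = rdot phi (rpart f) +i* rdot phi (ipart f).
Proof.
move=> Lf; rewrite L2dotE//; last exact: cphi_L2.
have -> : ipart cphi = fun=> 0 by [].
have -> : rpart cphi = phi by [].
by rewrite !(rdotC _ (fun=> 0)) !rdot0l addr0 subr0 !(rdotC phi).
Qed.

Lemma cphi_orth f : in_L2 f -> L2dot f cphi = 0 <->
  rdot phi (rpart f) = 0 /\ rdot phi (ipart f) = 0.
Proof.
by move=> Lf; rewrite L2dot_cphi//; split => [[]|[-> ->]].
Qed.

Lemma rpart_SLexpr w : rpart (SLexpr p q w) = SLreal p q (rpart w).
Proof. by apply/funext => x; rewrite /rpart SLexprE. Qed.

Lemma ipart_SLexpr w : ipart (SLexpr p q w) = SLreal p q (ipart w).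
Proof. by apply/funext => x; rewrite /ipart SLexprE. Qed.

Lemma domA00_green w : domA00 p q alpha w ->
  (forall x, 0 < x -> cgreen (SLexpr p q w) x = w x) /\
  L2dot (SLexpr p q w) cphi = 0.
Proof.
move=> [[cr ci] woo [a [b [[[ar ai] [br bi]] ab]]] LA].
have [LAr LAi] := (in_L2P _).1 LA.
rewrite rpart_SLexpr in LAr; rewrite ipart_SLexpr in LAi.
have ab' : boundary_relation alpha (complex.Re a) (complex.Re b) /\
    boundary_relation alpha (complex.Im a) (complex.Im b).
  move: ab; rewrite /boundary_relation; case: alpha => [al|] -> //.
  by rewrite ReM_real ImM_real.
have roo : \forall x \near +oo, rpart w x = 0 by apply: filterS woo => x; rewrite /rpart => ->.
have ioo : \forall x \near +oo, ipart w x = 0 by apply: filterS woo => x; rewrite /ipart => ->.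
have [gr or] := real_domain p_C1 q_C0 p_lim phi_L2 theta_L2 phi_reg theta_reg
  phi_eq theta_eq wronskian1 phi_lim dphi_lim theta_lim dtheta_lim cr roo ar br ab'.1 LAr.
have [gi oi] := real_domain p_C1 q_C0 p_lim phi_L2 theta_L2 phi_reg theta_reg
  phi_eq theta_eq wronskian1 phi_lim dphi_lim theta_lim dtheta_lim ci ioo ai bi ab'.2 LAi.
split; last by rewrite L2dot_cphi// rpart_SLexpr ipart_SLexpr or oi.
by move=> x x0; rewrite /cgreen rpart_SLexpr ipart_SLexpr gr// gi// -complex_parts.
Qed.

Lemma A00_green v g : A00 p q alpha (v, g) ->
  L2eq v (cgreen g) /\ L2dot g cphi = 0.
Proof.
move=> [/= Lv Lg [w dw [vw gw]]]; have [gw' ow] := domA00_green dw.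
have [_ _ _ LA] := dw; split.
  apply: L2eq_trans vw _; apply: (@L2eq_trans _ _ (cgreen (SLexpr p q w))).
    by apply: L2eq_halfline => x x0; rewrite gw'.
  by apply: cgreen_ae => //; exact: L2eq_sym.
by rewrite -ow; apply: L2dot_ae => //; [exact: cphi_L2..|exact: L2eq_refl].
Qed.

Lemma in_L2_halfline u v : in_L2 u -> (forall x, 0 < x -> u x = v x) -> in_L2 v.
Proof.
move=> Lu uv; have /in_L2P[[ur _] [ui _]] := Lu.
apply: (in_L2_ae Lu); last exact: L2eq_halfline.
  by apply: eq_measurable_fun ur => x; rewrite inE => /uv; rewrite /rpart => ->.
by apply: eq_measurable_fun ui => x; rewrite inE => /uv; rewrite /ipart => ->.
Qed.

Lemma green_A00 f : test_function (rpart f) -> test_function (ipart f) ->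
  in_L2 f -> L2dot f cphi = 0 -> A00 p q alpha (cgreen f, f).
Proof.
move=> tr ti Lf /(cphi_orth Lf)[or oi].
have [cr zr [ar [br [lar lbr abr]]] er] := test_function_green p_C1 q_C0 p_gt0
  phi_L2 theta_L2 phi_reg theta_reg phi_eq theta_eq wronskian1 phi_lim dphi_lim tr or.
have [ci zi [ai [bi [lai lbi abi]]] ei] := test_function_green p_C1 q_C0 p_gt0
  phi_L2 theta_L2 phi_reg theta_reg phi_eq theta_eq wronskian1 phi_lim dphi_lim ti oi.
have e x : 0 < x -> f x = SLexpr p q (cgreen f) x.
  by move=> x0; rewrite SLexprE er// ei// -complex_parts.
split; [exact: cgreen_L2|exact: Lf|].
exists (cgreen f); last by split; [exact: L2eq_refl|exact: L2eq_halfline].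
split; [exact: (conj cr ci)| |exists (ar +i* ai), (br +i* bi); split|].
- by apply: filterS2 zr zi => x; rewrite /cgreen => -> ->.
- exact: (conj (conj lar lai) (conj lbr lbi)).
- by move: abr abi; rewrite /boundary_relation; case: alpha => [al|] -> -> //; simpc.
- exact: in_L2_halfline e.
Qed.

Lemma A00_sub_Amin v g : A00 p q alpha (v, g) -> Amin p q alpha (v, g).
Proof.
move=> A; have [/= Lv Lg _] := A; split => // e e0; exists v, g.
have d0 u : in_L2 u -> L2dist u u = 0.
  move=> Lu; rewrite L2distE//.
  have n0 (h : R -> R) : rnorm (fun x => h x - h x) = 0.
    by under eq_fun do rewrite subrr; rewrite /rnorm rdot0l sqrtr0.
  by rewrite !n0 expr0n addr0 sqrtr0.
by split => //=; rewrite d0.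
Qed.

Lemma rnorm_eq0_ae (h : R -> R) : real_L2 h -> (forall e, 0 < e -> rnorm h < e) ->
  ae_eq mu D h (fun=> 0).
Proof.
move=> Lh h0; apply: rdot_eq0 => //; rewrite -rnorm2.
apply/eqP; rewrite expf_eq0/= eq_le rnorm_ge0 andbT leNgt; apply/negP => /h0.
by rewrite ltxx.
Qed.

Lemma ae_eq_subr0 (h k : R -> R) : ae_eq mu D (fun x => h x - k x) (fun=> 0) ->
  ae_eq mu D h k.
Proof.
by apply: filterS => x hk Dx; apply/eqP; rewrite -subr_eq0; apply/eqP; exact: hk.
Qed.

(** The relations c = G d and <phi, d> = 0 survive limits because G is bounded and pairing with phi
    is continuous. The real form serves both the real and the imaginary part. *)
Let closure_part (a b : R -> R) : real_L2 a -> real_L2 b ->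
  (forall e : R, 0 < e -> exists c d, [/\ real_L2 c, real_L2 d,
     rnorm (fun x => a x - c x) < e, rnorm (fun x => b x - d x) < e &
     ae_eq mu D c (green phi theta d) /\ rdot phi d = 0]) ->
  ae_eq mu D a (green phi theta b) /\ rdot phi b = 0.
Proof.
move=> La Lb h; pose C := 2 * (rnorm phi * rnorm theta).
have C0 : 0 <= C by rewrite !mulr_ge0 ?rnorm_ge0.
split.
  apply: ae_eq_subr0; apply: rnorm_eq0_ae.
    by apply: real_L2B => //; exact: green_L2.
  move=> e e0; have C1 : 0 < 1 + C by rewrite ltr_wpDr.
  have [c [d [Lc Ld ac bd [cd _]]]] := h _ (divr_gt0 e0 C1).
  have Lbd : real_L2 (fun x => green phi theta d x - green phi theta b x).
    by apply: real_L2B; exact: green_L2.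
  (* Replacing c by G d splits the error into a - c and G d - G b; the bounds e/(1+C) and C e/(1+C)
     add up to e. *)
  have -> : rnorm (fun x => a x - green phi theta b x) =
      rnorm (fun x => (a x - c x) + (green phi theta d x - green phi theta b x)).
    rewrite /rnorm; congr Num.sqrt.
    have L1 := real_L2B La (green_L2 phi_L2 theta_L2 Lb).
    have L2 := real_L2D (real_L2B La Lc) Lbd.
    have ae : ae_eq mu D (fun x => a x - green phi theta b x)
       (fun x => (a x - c x) + (green phi theta d x - green phi theta b x)).
      by apply: filterS cd => x cdx Dx; rewrite cdx// subrKA.
    by apply: rdot_ae => //; [exact: L2.1|exact: L2.1].
  apply: le_lt_trans (rnorm_triangle (real_L2B La Lc) Lbd) _.
  have db : rnorm (fun x => green phi theta d x - green phi theta b x) <= C * (e / (1 + C)).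
    apply: le_trans (rnorm_greenB phi_L2 theta_L2 Ld Lb) _; rewrite ler_wpM2l//.
    have -> : rnorm (fun x => d x - b x) = rnorm (fun x => -1 * (b x - d x)).
      by congr rnorm; apply/funext => x; ring.
    by rewrite rnormZ ?normrN1 ?mul1r ?ltW//; exact: real_L2B.
  apply: lt_le_trans (ltr_leD ac db) _.
  by rewrite -[X in X + _]mul1r -mulrDl mulrC divfK// gt_eqF.
apply/eqP; rewrite -normr_eq0 eq_le normr_ge0 andbT; apply/ler_addgt0Pr => e e0.
rewrite add0r; have P1 : 0 < 1 + rnorm phi by rewrite ltr_wpDr ?rnorm_ge0.
have [c [d [Lc Ld ac bd [cd phid]]]] := h _ (divr_gt0 e0 P1).
have -> : rdot phi b = rdot (fun x => b x - d x) phi.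
  by rewrite rdotBl// (rdotC d) phid subr0 rdotC.
apply: le_trans (rdot_norm (real_L2B Lb Ld) phi_L2) _.
apply: (@le_trans _ _ (e / (1 + rnorm phi) * (1 + rnorm phi))).
  by apply: ler_pM; rewrite ?rnorm_ge0 ?ltW// ltrDr.
by rewrite divfK// gt_eqF.
Qed.

Lemma Amin_green u f : Amin p q alpha (u, f) ->
  [/\ in_L2 u, in_L2 f, L2eq u (cgreen f) & L2dot f cphi = 0].
Proof.
move=> [/= Lu Lf cl]; split => //; have [Lur Lui] := (in_L2P _).1 Lu;
  have [Lfr Lfi] := (in_L2P _).1 Lf.
all: have [aer or] : ae_eq mu D (rpart u) (green phi theta (rpart f)) /\
    rdot phi (rpart f) = 0.
1,3: apply: closure_part => // e /cl[v [g [A ud fd]]];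
  have [/= Lv Lg _] := A; have [Lvr Lvi] := (in_L2P _).1 Lv;
  have [Lgr Lgi] := (in_L2P _).1 Lg; have [/L2eqP[vr vi] /(cphi_orth Lg)[gr gi]] := A00_green A;
  exists (rpart v), (rpart g); split => //;
  by [exact: le_lt_trans (L2dist_ger _ _) ud|exact: le_lt_trans (L2dist_ger _ _) fd].
all: have [aei oi] : ae_eq mu D (ipart u) (green phi theta (ipart f)) /\
    rdot phi (ipart f) = 0.
1,3: apply: closure_part => // e /cl[v [g [A ud fd]]];
  have [/= Lv Lg _] := A; have [Lvr Lvi] := (in_L2P _).1 Lv;
  have [Lgr Lgi] := (in_L2P _).1 Lg; have [/L2eqP[vr vi] /(cphi_orth Lg)[gr gi]] := A00_green A;
  exists (ipart v), (ipart g); split => //;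
  by [exact: le_lt_trans (L2dist_gei _ _) ud|exact: le_lt_trans (L2dist_gei _ _) fd].
  exact/L2eqP.
exact/cphi_orth.
Qed.

Lemma rnorm_ae (h k : R -> R) : real_L2 h -> real_L2 k -> ae_eq mu D h k ->
  rnorm h = rnorm k.
Proof.
by move=> Lh Lk hk; congr Num.sqrt; apply: rdot_ae => //; [exact: Lk.1|exact: Lk.1].
Qed.

Lemma ae_eq_sub_cst (h k l : R -> R) : ae_eq mu D h k ->
  ae_eq mu D (fun x => h x - l x) (fun x => k x - l x).
Proof. by apply: filterS => x hk Dx; rewrite hk. Qed.

(** Functions of class C^2 supported away from 0 and infinity already lie in the domain of A_00,
    with zero boundary data. *)
Lemma Amin_dense : densely_defined (Amin p q alpha).
Proof.
move=> u Lu e e0; have [Lur Lui] := (in_L2P _).1 Lu.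
have e2 : 0 < e / 2 by rewrite divr_gt0.
have [gr [br cr nr]] := real_L2_dense Lur e2.
have [gi [bi ci ni]] := real_L2_dense Lui e2.
pose v x := gr x +i* gi x.
have Lv : in_L2 v by apply/in_L2P; split; exact: bounded_supported_L2.
exists v; last first.
  apply: le_lt_trans (L2dist_le Lu Lv) _; rewrite [ltRHS]splitr.
  exact: ltrD.
have bs (g : R -> R) : bounded_supported g -> Ck 2 g ->
    [/\ real_L2 (SLreal p q g), (\forall x \near +oo, g x = 0),
     g x @[x --> 0^'+] --> 0 & derive1 g x @[x --> 0^'+] --> 0].
  move=> [_ _ [a [b [a0 sg]]]] cg.
  have oa : open `]-oo, a[%classic by exact: interval_open.
  have ob : open `]b, +oo[%classic by exact: interval_open.
  have ga y : `]-oo, a[%classic y -> g y = (fun=> 0) y.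
    by rewrite /= in_itv/= => ya; apply: sg; left.
  have gb y : `]b, +oo[%classic y -> g y = (fun=> 0) y.
    by rewrite /= in_itv/= andbT => ya; apply: sg; right.
  split.
  - have [] // := @test_function_of_support _ (SLreal p q g) a b a0.
      exact: SLreal_continuous.
    move=> x x0 [xa|bx].
      have Ax : `]-oo, a[%classic x by rewrite /= in_itv/=.
      by rewrite (SLreal_open p q oa Ax ga) SLreal0.
    have Bx : `]b, +oo[%classic x by rewrite /= in_itv/= bx.
    by rewrite (SLreal_open p q ob Bx gb) SLreal0.
  - by exists b; split; [exact: num_real|move=> x bx; apply: sg; right].
  - apply: cvg_near_cst; near=> x; apply: sg; left.
    by near: x; exact: nbhs_right_lt.
  - apply: cvg_near_cst; near=> x.
    have Ax : `]-oo, a[%classic x.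
      by rewrite /= in_itv/=; near: x; exact: nbhs_right_lt.
    by rewrite (derive1_open oa Ax ga) derive1_cst.
have [Sr oor lr dlr] := bs _ br cr; have [Si ooi li dli] := bs _ bi ci.
have LS : in_L2 (SLexpr p q v).
  by apply/in_L2P; rewrite rpart_SLexpr ipart_SLexpr; split; [exact: Sr|exact: Si].
exists (SLexpr p q v); apply: A00_sub_Amin; split; [exact: Lv|exact: LS|].
exists v; last by split; exact: L2eq_refl.
split; [exact: (conj cr ci)| |exists 0, 0; split|exact: LS].
- by apply: filterS2 oor ooi => x; rewrite /v => -> ->.
- exact: (conj (conj lr li) (conj dlr dli)).
- by case: alpha => [al|] //; rewrite mulr0.
Unshelve. all: by end_near. Qed.

(** With v in the domain close to f, orthogonality turns the square of the norm of f into the real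
    part of <f - v, f>, which is small. This is what makes the adjoint single-valued. *)
Lemma Amin_orth0 f : in_L2 f ->
  (forall u g, Amin p q alpha (u, g) -> L2dot f u = 0) -> L2eq f (fun=> 0).
Proof.
move=> Lf f0; apply: L2dot_eq0 => //.
have [Lfr Lfi] := (in_L2P _).1 Lf.
set fr := rpart f in Lfr; set fi := ipart f in Lfi.
suff N0 : rdot fr fr + rdot fi fi = 0.
  by rewrite L2dotE// -/fr -/fi N0 (rdotC fi) subrr.
apply/eqP; rewrite eq_le addr_ge0 ?rdot_ge0// andbT; apply/ler_addgt0Pr => e e0.
pose K := 1 + (rnorm fr + rnorm fi).
have K0 : 0 < K by rewrite ltr_wpDr// addr_ge0 ?rnorm_ge0.
have [v [g Avg] fv] := Amin_dense Lf (divr_gt0 e0 K0).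
have [/= Lv _ _] := Avg; have [Lvr Lvi] := (in_L2P _).1 Lv.
have := f0 _ _ Avg; rewrite L2dotE// => -[vr0 _].
have -> : rdot fr fr + rdot fi fi =
    rdot (fun x => fr x - rpart v x) fr + rdot (fun x => fi x - ipart v x) fi.
  rewrite !rdotBl// -[LHS]subr0 -vr0 -/fr -/fi (rdotC fr (rpart v)) (rdotC fi (ipart v)).
  by ring.
have bnd (h k : R -> R) : real_L2 h -> real_L2 k -> rnorm h <= L2dist f v ->
    rdot h k <= e / K * rnorm k.
  move=> Lh Lk hf; apply: le_trans (ler_norm _) _.
  apply: le_trans (rdot_norm Lh Lk) _; apply: ler_wpM2r; first exact: rnorm_ge0.
  exact: le_trans hf (ltW fv).
have br := bnd _ _ (real_L2B Lfr Lvr) Lfr (L2dist_ger Lf Lv).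
have bi := bnd _ _ (real_L2B Lfi Lvi) Lfi (L2dist_gei Lf Lv).
rewrite add0r; apply: le_trans (lerD br bi) _; rewrite -mulrDr mulrAC ler_pdivrMr//.
by rewrite ler_pM2l// /K lerDr.
Qed.

Variable omega : R -> R.
Hypothesis omega_cutoff : cutoff omega.

(** Test functions g orthogonal to phi approximate f while G g approximates G f, which is
    convergence in the graph norm. *)
Lemma green_Amin u f : in_L2 u -> in_L2 f -> L2eq u (cgreen f) ->
  L2dot f cphi = 0 -> Amin p q alpha (u, f).
Proof.
move=> Lu Lf /L2eqP[aer aei] /(cphi_orth Lf)[or oi]; split => //= e e0.
have [Lur Lui] := (in_L2P _).1 Lu; have [Lfr Lfi] := (in_L2P _).1 Lf.
have e2 : 0 < e / 2 by rewrite divr_gt0.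
have [gr [tr ogr nr ngr]] := test_function_dense p_C1 q_C0 p_gt0 phi_L2 theta_L2
  phi_reg theta_reg phi_eq theta_eq wronskian1 omega_cutoff Lfr or e2.
have [gi [ti ogi ni ngi]] := test_function_dense p_C1 q_C0 p_gt0 phi_L2 theta_L2
  phi_reg theta_reg phi_eq theta_eq wronskian1 omega_cutoff Lfi oi e2.
have [Lgr _ _] := tr; have [Lgi _ _] := ti.
have LGfr := green_L2 phi_L2 theta_L2 Lfr; have LGfi := green_L2 phi_L2 theta_L2 Lfi.
have LGgr := green_L2 phi_L2 theta_L2 Lgr; have LGgi := green_L2 phi_L2 theta_L2 Lgi.
pose g x := gr x +i* gi x.
have Lg : in_L2 g by apply/in_L2P.
have og : L2dot g cphi = 0 by apply/cphi_orth.
exists (cgreen g), g; split; first exact: green_A00.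
  apply: le_lt_trans (L2dist_le Lu (cgreen_L2 Lg)) _; rewrite [ltRHS]splitr.
  apply: ltrD.
    apply: le_lt_trans ngr; rewrite (rnorm_ae (real_L2B Lur LGgr) (real_L2B LGfr LGgr))//.
    exact: ae_eq_sub_cst.
  apply: le_lt_trans ngi; rewrite (rnorm_ae (real_L2B Lui LGgi) (real_L2B LGfi LGgi))//.
  exact: ae_eq_sub_cst.
apply: le_lt_trans (L2dist_le Lf Lg) _; rewrite [ltRHS]splitr.
exact: ltrD.
Qed.

End MinimalOperator.

(** * Extensions of an operator with rank-one defect *)

Section Extensions.
Context {R : realType}.
Implicit Types (u v f g k w : R -> R[i]) (c : R[i]) (t : option R).
(** An abstract form of the situation: [T0] is A_min, [G] the Green operator, [P] the real solution
    phi, and [f0] the source whose image is the cut-off theta [h0]. The given functions [phi0] and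
    [h0] are kept apart from [P] and [G f0], to which they are tied only by [L2eq]. *)
Variables (G : (R -> R[i]) -> (R -> R[i])) (P f0 phi0 h0 : R -> R[i]) (T0 : graph R).
Hypotheses (P_L2 : in_L2 P) (f0_L2 : in_L2 f0) (phi0_L2 : in_L2 phi0) (h0_L2 : in_L2 h0)
  (f0P : L2dot f0 P = 1) (phi0P : L2eq phi0 P) (h0G : L2eq h0 (G f0))
  (G_L2 : forall f, in_L2 f -> in_L2 (G f))
  (G_sym : forall f g, in_L2 f -> in_L2 g -> L2dot (G f) g = L2dot f (G g))
  (G_lin : forall c f g, in_L2 f -> in_L2 g ->
     L2eq (G (fun x => c * f x + g x)) (fun x => c * G f x + G g x))
  (G_ae : forall f g, in_L2 f -> in_L2 g -> L2eq f g -> L2eq (G f) (G g))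
  (T0P : forall u f, T0 (u, f) <->
     [/\ in_L2 u, in_L2 f, L2eq u (G f) & L2dot f P = 0])
  (T0_dense : densely_defined T0)
  (T0_orth : forall f, in_L2 f -> (forall u g, T0 (u, g) -> L2dot f u = 0) ->
     L2eq f (fun=> 0)).

Let in_L2Z c f : in_L2 f -> in_L2 (fun x => c * f x).
Proof.
by move=> Lf; have := in_L2_lin c Lf in_L2_0; under eq_fun do rewrite addr0.
Qed.

Let L2dotZl c f g : in_L2 f -> in_L2 g -> L2dot (fun x => c * f x) g = c * L2dot f g.
Proof.
move=> Lf Lg; have := L2dot_linl c Lf in_L2_0 Lg.
under eq_fun do rewrite addr0.
have -> : L2dot (fun=> 0 : R[i]) g = 0.
  have := L2dot_linl (-1) in_L2_0 in_L2_0 Lg.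
  under eq_fun do rewrite mulr0 addr0; rewrite mulN1r addNr; exact.
by rewrite addr0.
Qed.

Let L2dot0l g : in_L2 g -> L2dot (fun=> 0 : R[i]) g = 0.
Proof.
move=> Lg; have := L2dotZl 0 in_L2_0 Lg.
by under eq_fun do rewrite mul0r; rewrite mul0r.
Qed.

Let G_0 : L2eq (G (fun=> 0)) (fun=> 0).
Proof.
have := G_lin (-1) in_L2_0 in_L2_0.
under [X in L2eq (G X) _]eq_fun do rewrite mulr0 addr0.
by apply: filterS => x /[apply]; rewrite mulN1r addNr.
Qed.

Let conj_realM (s : R) (z : R[i]) : conjc (s%:C * z) = s%:C * conjc z.
Proof. by case: z => a b; simpc. Qed.

Lemma L2dot_PP_neq0 : L2dot P P != 0.
Proof.
apply/eqP => /(L2dot_eq0 P_L2) P0.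
have : L2dot P f0 = L2dot (fun=> 0) f0.
  by apply: L2dot_ae => //; [exact: in_L2_0|exact: L2eq_refl].
rewrite L2dot0l// L2dot_conj// f0P => /eqP.
by rewrite conjc1 oner_eq0.
Qed.

(** The defect r = u - G f is orthogonal to everything orthogonal to P. Its component k orthogonal
    to P is therefore orthogonal to r and to P, hence to itself. *)
Lemma maximalP u f : adjoint T0 (u, f) <->
  [/\ in_L2 u, in_L2 f & exists c, L2eq u (fun x => c * P x + G f x)].
Proof.
split=> [[/= Lu Lf uf]|[Lu Lf [c uE]]]; last first.
  split => //= w k /T0P[Lw Lk wk kP]; have LGf := G_L2 Lf; have LGk := G_L2 Lk.
  have LcP := in_L2_lin c P_L2 LGf.
  rewrite (L2dot_ae Lk Lk Lu LcP (L2eq_refl k) uE) L2dot_linr// kP mulr0 add0r.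
  by rewrite -G_sym//; apply: L2dot_ae => //; [exact: L2eq_sym|exact: L2eq_refl].
split => //; have LGf := G_L2 Lf.
pose r x := -1 * G f x + u x.
have Lr : in_L2 r by exact: in_L2_lin.
pose c := L2dot r P / L2dot P P.
pose k x := - c * P x + r x.
have Lk : in_L2 k by exact: in_L2_lin.
have kP : L2dot k P = 0.
  by rewrite L2dot_linl// /c mulNr divfK ?addNr// L2dot_PP_neq0.
(* As k is orthogonal to P, the pair (G k, k) lies in [T0], and the adjoint relation gives <k, u> =
   <G k, f> = <k, G f>. *)
have kr : L2dot k r = 0.
  rewrite L2dot_linr// rmorphN1 mulN1r -G_sym//.
  have -> : L2dot k u = L2dot (G k) f.
    by apply: uf; apply/T0P; split => //; [exact: G_L2|exact: L2eq_refl].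
  by rewrite addNr.
have k0 : L2eq k (fun=> 0).
  by apply: L2dot_eq0 => //; rewrite {2}/k L2dot_linr// kP kr mulr0 addr0.
exists c; move: k0; apply: filterS => x /[apply]; rewrite /k /r => e.
by rewrite -[RHS]addr0 -[X in _ = _ + X]e; ring.
Qed.

Lemma maximal_uniq u f g : adjoint T0 (u, f) -> adjoint T0 (u, g) -> L2eq f g.
Proof.
move=> [/= Lu Lf uf] [_ /= Lg ug].
have Lfg : in_L2 (fun x => -1 * g x + f x) by exact: in_L2_lin.
have : L2eq (fun x => -1 * g x + f x) (fun=> 0).
  apply: T0_orth => // w k wk; have [Lw Lk _ _] := (T0P _ _).1 wk.
  rewrite L2dot_linl// (L2dot_conj Lw Lg) (L2dot_conj Lw Lf) -(ug _ _ wk) -(uf _ _ wk).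
  by rewrite mulN1r addNr.
apply: filterS => x /[apply] e.
by rewrite -[RHS]addr0 -[X in _ = _ + X]e; ring.
Qed.

(** Shaped like [ext_vector], with [h0] for the cut-off theta, so that [extension] becomes [At] by
    conversion. *)
Definition extension_vector t : R -> R[i] :=
  if t is Some s then fun x => s%:C * phi0 x + h0 x else phi0.

Definition extension t : graph R :=
  op_restrict (adjoint T0) (add_line (domain T0) (extension_vector t)).

Lemma extension_vector_L2 t : in_L2 (extension_vector t).
Proof. by case: t => [s|] //; exact: in_L2_lin. Qed.

(** If u = v + c (s phi0 + h0) with v = G k, then u = s c P + G(c f0 + k). Hence f = c f0 + k by
    single-valuedness of the adjoint, and pairing with P recovers c = <f, P>. *)
Lemma extension_SomeP s u f : extension (Some s) (u, f) <->
  [/\ in_L2 u, in_L2 f & L2eq u (fun x => s%:C * L2dot f P * P x + G f x)].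
Proof.
split=> [[uf [v [c [[k /T0P[Lv Lk vk kP]] /= uE]]]]|[Lu Lf uE]].
  have [Lu Lf _] := (maximalP _ _).1 uf; split => //.
  have Lcg : in_L2 (fun x => c * f0 x + k x) by exact: in_L2_lin.
  have uE' : L2eq u (fun x => s%:C * c * P x + G (fun x => c * f0 x + k x) x).
    apply: L2eq_trans (_ : L2eq _ (fun x => s%:C * c * P x + (c * G f0 x + G k x))) _.
      move: vk phi0P h0G; apply: filterS3 => x hv hp hh Dx.
      by rewrite uE hv// hp// hh//; ring.
    have := L2eq_sym (G_lin c f0_L2 Lk); apply: filterS => x h Dx.
    by rewrite -h.
  have fE : L2eq f (fun x => c * f0 x + k x).
    by apply: (maximal_uniq uf); apply/maximalP; split => //; exists (s%:C * c).
  have fP : L2dot f P = c.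
    rewrite (L2dot_ae Lf Lcg P_L2 P_L2 fE (L2eq_refl P)) L2dot_linl// f0P kP.
    by rewrite mulr1 addr0.
  have := G_ae Lf Lcg fE; move: uE'; apply: filterS2 => x h1 h2 Dx.
  by rewrite fP h1// h2.
split; first by apply/maximalP; split => //; eexists; exact: uE.
pose c := L2dot f P.
pose v x := - c * extension_vector (Some s) x + u x.
have Lv : in_L2 v by apply: in_L2_lin => //; exact: extension_vector_L2.
exists v, c; split; last by apply/funext => x; rewrite /v /=; ring.
exists (fun x => - c * f0 x + f x); apply/T0P; split => //.
- exact: in_L2_lin.
- apply: L2eq_trans (_ : L2eq _ (fun x => - c * G f0 x + G f x)) _.
    move: uE phi0P h0G; apply: filterS3 => x hu hp hh Dx.
    by rewrite /v /= hu// hp// hh// -/c; ring.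
  exact: L2eq_sym (G_lin _ f0_L2 Lf).
- by rewrite L2dot_linl// f0P mulr1 addNr.
Qed.

(** The added line consists of multiples of P, which the maximal operator annihilates, so f stays
    orthogonal to P. *)
Lemma extension_NoneP u f : extension None (u, f) <->
  [/\ in_L2 u, in_L2 f, L2dot f P = 0 & exists c, L2eq u (fun x => c * P x + G f x)].
Proof.
split=> [[uf [v [c [[k /T0P[Lv Lk vk kP]] /= uE]]]]|[Lu Lf fP [c uE]]].
  have [Lu Lf uf'] := (maximalP _ _).1 uf; split => //.
  have fE : L2eq f k.
    apply: (maximal_uniq uf); apply/maximalP; split => //; exists c.
    move: vk phi0P; apply: filterS2 => x hv hp Dx.
    by rewrite uE hv// hp//; ring.
  by rewrite (L2dot_ae Lf Lk P_L2 P_L2 fE (L2eq_refl P)).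
split; first by apply/maximalP; split => //; eexists; exact: uE.
pose v x := - c * phi0 x + u x.
have Lv : in_L2 v by exact: in_L2_lin.
exists v, c; split; last by apply/funext => x; rewrite /v /=; ring.
exists f; apply/T0P; split => //.
move: uE phi0P; apply: filterS2 => x hu hp Dx.
by rewrite /v hu// hp//; ring.
Qed.

Lemma T0_sub_extension t u f : T0 (u, f) -> extension t (u, f).
Proof.
move=> /T0P[Lu Lf uE fP]; case: t => [s|].
  apply/extension_SomeP; split => //.
  by move: uE; apply: filterS => x h Dx; rewrite fP mulr0 mul0r add0r h.
apply/extension_NoneP; split => //; exists 0.
by move: uE; apply: filterS => x h Dx; rewrite mul0r add0r h.
Qed.

(** The restriction loses nothing, since every vector of the enlarged space already lies in the
    domain of the adjoint. *)
Lemma domain_extension t :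
  domain (extension t) = add_line (domain T0) (extension_vector t).
Proof.
apply/seteqP; split => [u [f [_ /= uh]]//|u uh].
have [v [c [[k vk] uE]]] := uh; have [Lv Lk vG kP] := (T0P _ _).1 vk.
have Lu : in_L2 u.
  have -> : u = fun x => c * extension_vector t x + v x.
    by apply/funext => x; rewrite uE addrC.
  by apply: in_L2_lin => //; exact: extension_vector_L2.
case: t uE uh => [s|] uE uh.
  exists (fun x => c * f0 x + k x); split => //; apply/maximalP; split => //.
    exact: in_L2_lin.
  exists (c * s%:C).
  apply: L2eq_trans (_ : L2eq _ (fun x => c * s%:C * P x + (c * G f0 x + G k x))) _.
    move: vG phi0P h0G; apply: filterS3 => x hv hp hh Dx.
    by rewrite uE /= hv// hp// hh//; ring.
  have := L2eq_sym (G_lin c f0_L2 Lk); apply: filterS => x h Dx.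
  by rewrite -h.
exists k; split => //; apply/maximalP; split => //; exists c.
move: vG phi0P; apply: filterS2 => x hv hp Dx.
by rewrite uE /= hv// hp//; ring.
Qed.

Lemma direct_line_extension t : direct_line (domain T0) (extension_vector t).
Proof.
move=> c [k /T0P[Lu Lk ck kP]].
(* Single-valuedness of the adjoint at the zero function: c'P + G f = 0 forces f = 0. *)
have zero_max f : in_L2 f -> (exists c', L2eq (fun=> 0) (fun x => c' * P x + G f x)) ->
    L2eq f (fun=> 0).
  move=> Lf h; apply: (@maximal_uniq (fun=> 0)); apply/maximalP; split => //.
    exact: in_L2_0.
    exact: in_L2_0.
    exact: in_L2_0.
  exists 0; have := G_0; apply: filterS => x /[apply] ->.
  by rewrite mul0r addr0.
case: t Lu ck => [s|] /= Lu ck; last first.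
  have k0 : L2eq k (fun=> 0).
    apply: zero_max => //; exists (- c).
    move: ck phi0P; apply: filterS2 => x hc hp Dx.
    by rewrite -hc// hp//; ring.
  have cP0 : L2eq (fun x => c * P x) (fun=> 0).
    move: (L2eq_trans (G_ae Lk in_L2_0 k0) G_0) ck phi0P.
    by apply: filterS3 => x hk hc hp Dx; rewrite -hp// hc// hk.
  have := L2dot_ae (in_L2Z c P_L2) in_L2_0 P_L2 P_L2 cP0 (L2eq_refl P).
  rewrite L2dotZl// L2dot0l// => /eqP.
  by rewrite mulf_eq0 (negPf L2dot_PP_neq0) orbF => /eqP.
have Lc : in_L2 (fun x => - c * f0 x + k x) by exact: in_L2_lin.
have k0 : L2eq (fun x => - c * f0 x + k x) (fun=> 0).
  apply: zero_max => //; exists (- (c * s%:C)).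
  apply: L2eq_trans (_ : L2eq _ (fun x => - (c * s%:C) * P x + (- c * G f0 x + G k x))) _.
    move: ck phi0P h0G; apply: filterS3 => x hc hp hh Dx.
    by rewrite -hc// hp// hh//; ring.
  have := L2eq_sym (G_lin (- c) f0_L2 Lk); apply: filterS => x h Dx.
  by rewrite -h.
have := L2dot_ae Lc in_L2_0 P_L2 P_L2 k0 (L2eq_refl P).
rewrite L2dot0l// L2dot_linl// f0P kP mulr1 addr0 => /eqP.
by rewrite oppr_eq0 => /eqP.
Qed.

Lemma extension_L2 t u f : extension t (u, f) -> in_L2 u /\ in_L2 f.
Proof. by move=> [[]]. Qed.

(** For real s the operator B = G + s <., P> P is defined on all of L^2, so the defect r = v - B g
    may itself be used as a test: the pair (B r, r) gives <r, v> = <B r, g> = <r, B g>, whence r =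
    0. *)
Lemma adjoint_extension_sub t : adjoint (extension t) `<=` extension t.
Proof.
move=> [v g] [/= Lv Lg vg]; case: t vg => [s|] vg.
  have LGg := G_L2 Lg.
  pose b := s%:C * L2dot g P.
  pose Bg x := b * P x + G g x.
  have LBg : in_L2 Bg by exact: in_L2_lin.
  pose r x := -1 * Bg x + v x.
  have Lr : in_L2 r by exact: in_L2_lin.
  pose Br x := s%:C * L2dot r P * P x + G r x.
  have LBr : in_L2 Br by apply: in_L2_lin => //; exact: G_L2.
  have rv : L2dot r v = L2dot Br g.
    by apply: vg; apply/extension_SomeP; split => //; exact: L2eq_refl.
  have sym : L2dot Br g = L2dot r Bg.
    have LGr := G_L2 Lr.
    rewrite L2dot_linl// L2dot_linr// G_sym// /b conj_realM (L2dot_conj Lg P_L2).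
    by ring.
  have r0 : L2eq r (fun=> 0).
    by apply: L2dot_eq0 => //; rewrite {2}/r L2dot_linr// rv sym rmorphN1 mulN1r addNr.
  apply/extension_SomeP; split => //; move: r0; apply: filterS => x /[apply].
  rewrite /r /Bg => e.
  by rewrite -[RHS]addr0 -[X in _ = _ + X]e /b; ring.
(* The pair (P, 0) belongs to [extension None] and tests g against P. *)
have gP : L2dot g P = 0.
  have := vg P (fun=> 0); rewrite L2dot0l// => h.
  rewrite (L2dot_conj P_L2 Lg) -h ?conjc0//.
  apply/extension_NoneP; split; [exact: P_L2|exact: in_L2_0|exact: L2dot0l|exists 1].
  by move: G_0; apply: filterS => x /[apply] ->; rewrite mul1r addr0.
have [_ _ vE] : [/\ in_L2 v, in_L2 g & exists c, L2eq v (fun x => c * P x + G g x)].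
  apply/maximalP; split => // w k wk; apply: vg.
  exact: (T0_sub_extension None).
exact/extension_NoneP.
Qed.

(** For finite t the rank-one terms agree because s is real; for t = oo they vanish by orthogonality
    to P. *)
Lemma extension_sub_adjoint t : extension t `<=` adjoint (extension t).
Proof.
move=> [v g] vg; have [Lv Lg] := extension_L2 vg; split => //= u f uf.
have [Lu Lf] := extension_L2 uf; have [LGf LGg] := (G_L2 Lf, G_L2 Lg).
case: t vg uf => [s /extension_SomeP[_ _ vE] /extension_SomeP[_ _ uE]|].
  rewrite (L2dot_ae Lf Lf Lv (in_L2_lin _ P_L2 LGg) (L2eq_refl f) vE).
  rewrite (L2dot_ae Lu (in_L2_lin _ P_L2 LGf) Lg Lg uE (L2eq_refl g)).
  rewrite L2dot_linl// L2dot_linr// G_sym// conj_realM (L2dot_conj Lg P_L2).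
  by ring.
move=> /extension_NoneP[_ _ gP [c vE]] /extension_NoneP[_ _ fP [d uE]].
rewrite (L2dot_ae Lf Lf Lv (in_L2_lin _ P_L2 LGg) (L2eq_refl f) vE).
rewrite (L2dot_ae Lu (in_L2_lin _ P_L2 LGf) Lg Lg uE (L2eq_refl g)).
rewrite L2dot_linl// L2dot_linr// G_sym// fP (L2dot_conj Lg P_L2) gP conjc0.
by rewrite !mulr0.
Qed.

Lemma adjoint_linear (T : graph R) c u f v g :
  (forall a b, T (a, b) -> in_L2 a /\ in_L2 b) ->
  adjoint T (u, f) -> adjoint T (v, g) ->
  adjoint T (fun x => c * u x + v x, fun x => c * f x + g x).
Proof.
move=> TL [/= Lu Lf uf] [/= Lv Lg vg]; split; [exact: in_L2_lin|exact: in_L2_lin|].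
move=> a b ab; have [La Lb] := TL _ _ ab.
by rewrite /= !L2dot_linr// (uf _ _ ab) (vg _ _ ab).
Qed.

Lemma self_adjoint_extension t : self_adjoint (extension t).
Proof.
have adjE : extension t = adjoint (extension t).
  by apply/seteqP; split; [exact: extension_sub_adjoint|exact: adjoint_extension_sub].
split => //.
  split.
  - exact: extension_L2.
  - move=> u f v g uf Lv Lg uv fg; rewrite adjE; split => //= a b ab.
    have [La Lb] := extension_L2 ab; have [Lu Lf] := extension_L2 uf.
    rewrite (L2dot_ae Lb Lb Lv Lu (L2eq_refl b) (L2eq_sym uv)).
    rewrite (L2dot_ae La La Lg Lf (L2eq_refl a) (L2eq_sym fg)).
    by move: uf; rewrite adjE => -[_ _]; exact.
  - apply: T0_sub_extension; apply/T0P.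
    by split; [exact: in_L2_0|exact: in_L2_0|exact: L2eq_sym G_0|exact: L2dot0l].
  - move=> c u f v g uf vg; rewrite adjE; apply: adjoint_linear.
    + exact: extension_L2.
    + by rewrite -adjE.
    + by rewrite -adjE.
  - by move=> u f g [uf _] [ug _]; exact: maximal_uniq uf ug.
move=> u Lu e e0; have [v [f vf] uv] := T0_dense Lu e0.
by exists v => //; exists f; exact: T0_sub_extension.
Qed.

(** It turns one inclusion between self-adjoint operators into equality. *)
Lemma adjoint_antitone (S T : graph R) : S `<=` T -> adjoint T `<=` adjoint S.
Proof.
by move=> ST [v g] [Lv Lg vg]; split => // u f /ST; exact: vg.
Qed.

Lemma self_adjoint_extensionP (A : graph R) : T0 `<=` A -> self_adjoint A ->
  A `<=` adjoint T0 -> exists t, A = extension t.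
Proof.
move=> T0A [[AL Aae A0 Alin _] _ Aadj] Amax.
have adjE t : extension t = adjoint (extension t).
  by have [] := self_adjoint_extension t.
have [[u [f [uf fP]]]|noP] := pselect (exists u f, A (u, f) /\ L2dot f P != 0); last first.
  exists None; have sub : A `<=` extension None.
    move=> [u f] uf; have [Lu Lf] := AL _ _ uf; apply/extension_NoneP.
    have [_ _ uE] := (maximalP _ _).1 (Amax _ uf); split => //.
    by apply/eqP/negPn/negP => fP; apply: noP; exists u, f.
  apply/seteqP; split => //; rewrite adjE [X in _ `<=` X]Aadj.
  exact: adjoint_antitone.
have [Lu Lf] := AL _ _ uf; pose a := (L2dot f P)^-1.
(* Normalisation to <f1, P> = 1; the summand 0 matches the linearity clause applied with the zero
   pair. *)
pose u1 x := a * u x + 0; pose f1 x := a * f x + 0.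
have uf1 : A (u1, f1) by exact: Alin uf A0.
have [Lu1 Lf1] := AL _ _ uf1; have LGf1 := G_L2 Lf1.
have f1P : L2dot f1 P = 1.
  by rewrite L2dot_linl ?L2dot0l ?addr0 ?mulVf//; exact: in_L2_0.
have [_ _ [tau u1E]] := (maximalP _ _).1 (Amax _ uf1).
have LtG := in_L2_lin tau P_L2 LGf1.
have tau_real : conjc tau = tau.
  have := uf1; rewrite Aadj => -[_ _ /(_ _ _ uf1)] /=.
  rewrite (L2dot_ae Lf1 Lf1 Lu1 LtG (L2eq_refl f1) u1E).
  rewrite (L2dot_ae Lu1 LtG Lf1 Lf1 u1E (L2eq_refl f1)).
  rewrite L2dot_linl// L2dot_linr// G_sym// (L2dot_conj Lf1 P_L2) f1P conjc1 !mulr1.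
  exact: addIr.
pose s := complex.Re tau.
have tauE : tau = s%:C.
  move: tau_real; rewrite /s; case: (tau) => x y [] /eqP; rewrite -subr_eq0 -opprD oppr_eq0.
  by rewrite -mulr2n mulrn_eq0 => /eqP ->.
have sub : extension (Some s) `<=` A.
  move=> [v g] /extension_SomeP[Lv Lg vE]; have LGg := G_L2 Lg.
  (* Subtracting b f1 makes the right-hand side orthogonal to P, so (G k, k) lies in [T0] and hence
     in [A]. *)
  pose b := L2dot g P; pose k x := - b * f1 x + g x.
  have Lk : in_L2 k by exact: in_L2_lin.
  have kA : A (G k, k).
    apply: T0A; apply/T0P; split => //; [exact: G_L2|exact: L2eq_refl|].
    by rewrite L2dot_linl// f1P mulr1 addNr.
  apply: (Aae _ _ _ _ (Alin b _ _ _ _ uf1 kA)) => //.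
    have := G_lin (- b) Lf1 Lg; move: u1E vE; apply: filterS3 => x hu hv hk Dx.
    by rewrite hu// hv// hk// tauE -/b; ring.
  by apply: L2eq_halfline => x _; rewrite /k; ring.
exists (Some s); apply/seteqP; split => //.
rewrite [X in X `<=` _]Aadj adjE; exact: adjoint_antitone.
Qed.

End Extensions.

(** * The limit circle theorem *)

Section FundamentalSystem.
Context {R : realType}.
Implicit Types (u : R -> R[i]) (x : R).

Lemma initial_data_parts u (a b : R[i]) : initial_data u a b ->
  [/\ rpart u x @[x --> 0^'+] --> complex.Re a,
      derive1 (rpart u) x @[x --> 0^'+] --> complex.Re b,
      ipart u x @[x --> 0^'+] --> complex.Im a &
      derive1 (ipart u) x @[x --> 0^'+] --> complex.Im b].
Proof.
move=> [[h1 h2] [h3 h4]].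
by split; [exact: h1|exact: h3|exact: h2|exact: h4].
Qed.

Lemma green0 (phi theta : R -> R) x : green phi theta (fun=> 0) x = 0.
Proof.
have z (h : R -> R) : (fun t => h t * 0) = fun=> 0 by apply/funext => t; rewrite mulr0.
by rewrite /green !z /int_below /int_above /Rintegral !integral0 !mulr0 addr0.
Qed.

End FundamentalSystem.

Theorem theorem2p4 (R : realType) (p q : R -> R) (p0 q0 : R)
    (alpha : option R) (phi theta : R[i] -> R -> R[i]) (omega : R -> R)
    (p_C1 : Ck 1 p) (q_C0 : Ck 0 q)
    (p_lim : p x @[x --> 0^'+] --> p0) (q_lim : q x @[x --> 0^'+] --> q0)
    (p_gt0 : forall x, 0 < x -> 0 < p x) (p0_gt0 : 0 < p0)
    (phi_sol : forall z, SLsolution p q z (phi z) /\ phi_data alpha (phi z))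
    (theta_sol : forall z,
       SLsolution p q z (theta z) /\ theta_data p0 alpha (theta z))
    (omega_cutoff : cutoff omega)
    (phi_L2 : forall z, in_L2 (phi z)) (theta_L2 : forall z, in_L2 (theta z)) :
  let A_min := Amin p q alpha in
  let A_max := Amax p q alpha in
  let h := ext_vector omega (phi 0) (theta 0) in
  let A_ := At p q alpha omega (phi 0) (theta 0) in
  (forall t : option R,
     [/\ domain (A_ t) = add_line (domain A_min) (h t),
         direct_line (domain A_min) (h t) &
         self_adjoint (A_ t)]) /\
  (forall A : graph R,
     A_min `<=` A -> self_adjoint A -> A `<=` A_max ->
     exists t : option R, A = A_ t).
Proof.
move=> A_min A_max h A_.
have [sphi dphi] := phi_sol 0; have [stheta dtheta] := theta_sol 0.
have [Lpr Lpi] := (in_L2P _).1 (phi_L2 0).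
have [Ltr Lti] := (in_L2P _).1 (theta_L2 0).
have [rpr rpi epr epi] := SLsolution_parts sphi.
have [rtr rti etr eti] := SLsolution_parts stheta.
set pr := rpart (phi 0) in Lpr rpr epr *; set pi := ipart (phi 0) in Lpi rpi epi *.
set tr := rpart (theta 0) in Ltr rtr etr *; set ti := ipart (theta 0) in Lti rti eti *.
have [lpr lpr' lpi lpi'] : [/\ pr x @[x --> 0^'+] --> ((if alpha is Some _ then 1 else 0) : R),
    derive1 pr x @[x --> 0^'+] --> ((if alpha is Some al then al else 1) : R),
    pi x @[x --> 0^'+] --> (0 : R) & derive1 pi x @[x --> 0^'+] --> (0 : R)].
  by move: dphi; rewrite /phi_data; case: (alpha) => [al|] /initial_data_parts[].
pose t0 : R := if alpha is Some _ then 0 else p0^-1.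
pose t1 : R := if alpha is Some _ then - p0^-1 else 0.
have [ltr ltr' lti lti'] : [/\ tr x @[x --> 0^'+] --> t0,
    derive1 tr x @[x --> 0^'+] --> t1,
    ti x @[x --> 0^'+] --> (0 : R) & derive1 ti x @[x --> 0^'+] --> (0 : R)].
  move: dtheta; rewrite /theta_data /t0 /t1; case: (alpha) => [al|] /initial_data_parts[] //=.
  by rewrite oppr0.
(* The factor 1/p(0) in the data of theta cancels the weight p(0), for finite and infinite alpha
   alike. *)
have W1 x : 0 < x -> wronskian p pr tr x = 1.
  apply: (wronskian_cst rpr rtr epr etr).
  have := wronskian_cvg p_lim lpr lpr' ltr ltr'.
  rewrite (_ : _ - _ = 1)// /t0 /t1.
  by case: (alpha) => [al|]; field; rewrite gt_eqF.
(* Meant for the imaginary parts of phi and theta, whose initial data vanish because the prescribed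
   data are real. *)
have zero w : SLregular p w -> (forall x, 0 < x -> SLreal p q w x = 0) ->
    w x @[x --> 0^'+] --> (0 : R) -> derive1 w x @[x --> 0^'+] --> (0 : R) ->
    forall x, 0 < x -> w x = 0.
  move=> rw ew w0 w0'; apply: (SLsolution_zero rpr rtr rw epr etr ew W1).
    have := wronskian_cvg p_lim w0 w0' lpr lpr'.
    by rewrite mulr0 !mul0r subrr.
  have := wronskian_cvg p_lim w0 w0' ltr ltr'.
  by rewrite mulr0 !mul0r subrr.
have pi0 := zero _ rpi epi lpi lpi'; have ti0 := zero _ rti eti lti lti'.
have [tf0 gf0 phif0] := cutoff_theta p_C1 q_C0 p_gt0 Lpr Ltr rpr rtr epr etr W1 omega_cutoff.
set f0 := SLreal p q _ in tf0 gf0 phif0; have [Lf0 _ _] := tf0.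
have Lcf0 : in_L2 (fun x => (f0 x)%:C).
  by apply/in_L2P; split; [exact: Lf0|exact: real_L2_0].
have f0P : L2dot (fun x => (f0 x)%:C) (cphi pr) = 1.
  rewrite (L2dot_cphi Lpr Lcf0).
  by rewrite (_ : rdot _ _ = 1)// (rdotC pr) rdot0l.
have phi0P : L2eq (phi 0) (cphi pr).
  apply: L2eq_halfline => x x0; rewrite [LHS]complex_parts.
  by rewrite -/pi pi0.
pose h0 x := (omega x)%:C * theta 0 x.
have h0E x : 0 < x -> cgreen pr tr (fun x => (f0 x)%:C) x = h0 x.
  move=> x0; rewrite /h0 [theta 0 x]complex_parts -/ti ti0// -/tr /cgreen.
  rewrite (gf0 _ x0) (green0 pr tr) -/tr.
  by simpc.
have h0G : L2eq h0 (cgreen pr tr (fun x => (f0 x)%:C)).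
  by apply: L2eq_halfline => x x0; rewrite h0E.
(* Square-integrability of the cut-off theta is read off from its representation as G f0. *)
have Lh0 : in_L2 h0.
  exact: in_L2_halfline (cgreen_L2 Lpr Ltr Lcf0) h0E.
have T0P u f : Amin p q alpha (u, f) <->
    [/\ in_L2 u, in_L2 f, L2eq u (cgreen pr tr f) & L2dot f (cphi pr) = 0].
  split=> [|[Lu Lf uf fP]].
    exact: (Amin_green p_C1 q_C0 p_lim Lpr Ltr rpr rtr epr etr W1 lpr lpr' ltr ltr').
  exact: (green_Amin p_C1 q_C0 p_gt0 Lpr Ltr rpr rtr epr etr W1 lpr lpr' omega_cutoff Lu Lf uf fP).
have G_lin c f g : in_L2 f -> in_L2 g ->
    L2eq (cgreen pr tr (fun x => c * f x + g x))
      (fun x => c * cgreen pr tr f x + cgreen pr tr g x).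
  by move=> Lf Lg; apply: L2eq_halfline => x; exact: cgreen_lin.
have G_L2 := cgreen_L2 Lpr Ltr; have G_sym := cgreen_sym Lpr Ltr.
have G_ae := cgreen_ae Lpr Ltr; have PL2 := cphi_L2 Lpr.
have dense := Amin_dense alpha p_C1 q_C0.
have orth f : in_L2 f -> (forall u g, Amin p q alpha (u, g) -> L2dot f u = 0) ->
    L2eq f (fun=> 0) by exact: Amin_orth0.
split=> [t|A minA saA Amax].
  split.
  - exact: (domain_extension PL2 Lcf0 (phi_L2 0) Lh0 f0P phi0P h0G G_L2 G_sym G_lin T0P t).
  - exact: (direct_line_extension PL2 Lcf0 f0P phi0P h0G G_L2 G_sym G_lin G_ae T0P orth (t := t)).
  - exact: (self_adjoint_extension PL2 Lcf0 (phi_L2 0) Lh0 f0P phi0P h0G G_L2 G_sym G_lin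
      G_ae T0P dense orth t).
exact: (self_adjoint_extensionP PL2 Lcf0 (phi_L2 0) Lh0 f0P phi0P h0G G_L2 G_sym G_lin
  G_ae T0P dense orth minA saA Amax).
Qed.
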